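(* Let $M\subset\mathbb{C}^N$ be a formal real hypersurface that belongs to the class $\mathcal{C}_m$ for some $m\ge1$. Then every formal CR-transversal holomorphic map $H\colon(\mathbb{C}^N,0)\to(\mathbb{C}^N,0)$ sending $M$ into itself is an automorphism.
   Context: For a formal power series $h(x)$ with complex coefficients, $\bar h(x)$ is the series obtained by conjugating the coefficients (similarly for formal maps). The generic rank of a formal map $F(x)$ is the largest $r$ such that some $r\times r$ minor of the Jacobian matrix $\partial F/\partial x$ is a nonzero formal power series. Formal real hypersurface $M\subset\mathbb{C}^N$ (through $0$): given by $r\in\mathbb{C}[[Z,\zeta]]$, $(Z,\zeta)\in\mathbb{C}^N\times\mathbb{C}^N$, with $\bar r(\zeta,Z)=r(Z,\zeta)$, $r(0)=0$ and $\partial_Z r(0)\neq 0$; $\mathcal{I}(M)$ is the ideal of $\mathbb{C}[[Z,\zeta]]$ generated by $r$, and $T^{1,0}_0M=\ker\partial_Zr(0)\subset T_0\mathbb{C}^N$. Normal coordinates: there is a formal change of coordinates $Z=Z(z,w)$ of $\mathbb{C}^N$, $z\in\mathbb{C}^{N-1}$, $w\in\mathbb{C}$, with associated change $\zeta=\bar Z(\chi,\tau)$, $\chi\in\mathbb{C}^{N-1}$, $\tau\in\mathbb{C}$, such that $M$ is defined by $w-Q(z,\chi,\tau)$, where $Q\in\mathbb{C}[[z,\chi,\tau]]$ satisfies $Q(0,\chi,\tau)=Q(z,0,\tau)=\tau$. $m$-infinite type: $M$ is of $m$-infinite type if in normal coordinates $Q(z,\chi,\tau)=\tau+\tau^m\widetilde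 Q(z,\chi,\tau)$ with $\widetilde Q(z,0,\tau)=\widetilde Q(0,\chi,\tau)=0$ and $\widetilde Q(z,\chi,0)\not\equiv0$. Class $\mathcal{C}_m$: $M$ belongs to the class $\mathcal{C}_m$ if it is of $m$-infinite type and, writing $\widetilde Q(z,\chi,0)=\sum_{\alpha\in\mathbb{N}^{N-1}}\widetilde Q_\alpha(\chi)z^\alpha$, the formal map $\chi\mapsto(\widetilde Q_\alpha(\chi))_{|\alpha|\le k}$ has generic rank $N-1$ for $k$ large enough. These conditions do not depend on the choice of normal coordinates. Maps: a formal holomorphic map $H\colon(\mathbb{C}^N,0)\to(\mathbb{C}^N,0)$ sends $M$ (defined by $r$) into itself if $r(H(Z),\bar H(\zeta))\in\mathcal{I}(M)$. $H$ is CR-transversal if $T^{1,0}_0M+dH(T_0\mathbb{C}^N)=T_0\mathbb{C}^N$, where $dH$ is the differential of $H$ at $0$; writing $H=(F,G)$ in normal coordinates $(z,w)$ for $M$, with $F$ having $N-1$ components and $G$ scalar, this is equivalent to $\partial G/\partial w(0)\neq0$. $H$ is an automorphism if it is an invertible formal map, i.e. its Jacobian determinant at $0$ is nonzero. *)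

(* Defs.v *)
From HB Require Import structures.
From mathcomp Require Import all_boot all_order all_algebra.
From mathcomp Require Import freeg mpoly complex.
From mathcomp Require Import boolp reals.

Set Implicit Arguments.
Unset Strict Implicit.
Unset Printing Implicit Defensive.

Import Order.TTheory GRing.Theory Num.Theory.
Local Open Scope ring_scope.

(* K[[x_1, ..., x_n]], as coefficient families; [f m] is the coefficient of    *)
(* the monomial x^m, so [f 0%MM] is the constant term f(0).                    *)
Record fps (K : comNzRingType) (n : nat) : Type :=
  Fps { fcoef :> 'X_{1..n} -> K }.

HB.instance Definition _ (K : comNzRingType) (n : nat) := gen_eqMixin (fps K n).
HB.instance Definition _ (K : comNzRingType) (n : nat) :=
  gen_choiceMixin (fps K n).

Section FpsRing.
Variables (K : comNzRingType) (n : nat).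
Implicit Types (f g h : fps K n) (m : 'X_{1..n}) (d : nat).

Lemma fpsP f g : (forall m, f m = g m) -> f = g.
Proof.
by case: f => f; case: g => g /= fg; congr Fps; apply/funext.
Qed.

Definition fps_const (c : K) : fps K n := Fps (fun m => if m == 0%MM then c else 0).
Definition fps_opp f : fps K n := Fps (fun m => - f m).
Definition fps_add f g : fps K n := Fps (fun m => f m + g m).
Definition fps_mul f g : fps K n :=
  Fps (fun m => \sum_(k : 'X_{1..n < (mdeg m).+1} | (k <= m)%MM)
                  f k * g (m - k)%MM).

Fact fps_addA : associative fps_add.
Proof. by move=> f g h; apply: fpsP => m /=; rewrite addrA. Qed.
Fact fps_addC : commutative fps_add.
Proof. by move=> f g; apply: fpsP => m /=; rewrite addrC. Qed.
Fact fps_add0 : left_id (fps_const 0) fps_add.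
Proof. by move=> f; apply: fpsP => m /=; rewrite if_same add0r. Qed.
Fact fps_addN : left_inverse (fps_const 0) fps_opp fps_add.
Proof. by move=> f; apply: fpsP => m /=; rewrite if_same addNr. Qed.

HB.instance Definition _ :=
  GRing.isZmodule.Build (fps K n) fps_addA fps_addC fps_add0 fps_addN.

(* The ring axioms are transferred from {mpoly K[n]} by truncation. *)
Definition fps_trunc d f : {mpoly K[n]} :=
  \sum_(k : 'X_{1..n < d}) f k *: 'X_[k].

Lemma mcoeff_fps_trunc d f m : (mdeg m < d)%N -> (fps_trunc d f)@_m = f m.
Proof.
move=> md; rewrite /fps_trunc raddf_sum /= (bigD1 (BMultinom md)) //= big1 => [|k].
  by rewrite addr0 mcoeffZ mcoeffX eqxx mulr1.
by move=> /eqP nk; rewrite mcoeffZ mcoeffX; case: eqP => [e|]; rewrite ?mulr0 //;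
  case: nk; apply: val_inj.
Qed.

Lemma fps_mulE_poly f g m (p q : {mpoly K[n]}) :
  (forall k, (mdeg k <= mdeg m)%N -> f k = p@_k) ->
  (forall k, (mdeg k <= mdeg m)%N -> g k = q@_k) ->
  fps_mul f g m = (p * q)@_m.
Proof.
move=> fp gq; rewrite [RHS](@mcoeff_poly_mul_lin _ _ p q m _ (ltnSn _)) /=.
apply: eq_bigr => k _; rewrite fp ?gq ?mdegB //.
by rewrite -ltnS bmdeg.
Qed.

Lemma fps_mulE d f g m : (mdeg m < d)%N ->
  fps_mul f g m = (fps_trunc d f * fps_trunc d g)@_m.
Proof.
move=> md; apply: fps_mulE_poly => k km; rewrite mcoeff_fps_trunc //;
  exact: leq_ltn_trans km md.
Qed.

Fact fps_mulA : associative fps_mul.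
Proof.
move=> f g h; apply: fpsP => m; pose t := fps_trunc (mdeg m).+1.
have tE (u : fps K n) k : (mdeg k <= mdeg m)%N -> u k = (t u)@_k.
  by move=> km; rewrite mcoeff_fps_trunc.
rewrite (@fps_mulE_poly _ _ _ (t f) (t g * t h)); first 1 last.
- by move=> k; apply: tE.
- by move=> k km; apply: fps_mulE.
rewrite (@fps_mulE_poly _ _ _ (t f * t g) (t h)) ?mulrA //.
  by move=> k km; apply: fps_mulE.
by move=> k; apply: tE.
Qed.

Fact fps_mulC : commutative fps_mul.
Proof.
by move=> f g; apply: fpsP => m; rewrite !(@fps_mulE (mdeg m).+1) // mulrC.
Qed.

Fact fps_mul1 : left_id (fps_const 1) fps_mul.
Proof.
move=> f; apply: fpsP => m; pose t := fps_trunc (mdeg m).+1.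
rewrite (@fps_mulE_poly _ _ _ 1 (t f)) => [|k km|k km].
- by rewrite mul1r mcoeff_fps_trunc.
- by rewrite mcoeff1 /=; case: eqP.
- by rewrite mcoeff_fps_trunc.
Qed.

Fact fps_mulDl : left_distributive fps_mul fps_add.
Proof.
move=> f g h; apply: fpsP => m /=; rewrite -big_split.
by apply: eq_bigr => k _; rewrite mulrDl.
Qed.

Fact fps_1_neq0 : fps_const 1 != 0.
Proof.
apply/eqP => /(congr1 (fun f : fps K n => f 0%MM)) /=.
by rewrite eqxx => /eqP; rewrite oner_eq0.
Qed.

HB.instance Definition _ := GRing.Zmodule_isComNzRing.Build (fps K n)
  fps_mulA fps_mulC fps_mul1 fps_mulDl fps_1_neq0.

End FpsRing.

Section FpsCalculus.
Variable K : comNzRingType.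

Definition fps_var n (i : 'I_n) : fps K n :=
  Fps (fun m => if m == U_(i)%MM then 1 else 0).

Definition fps_vars n : 'rV[fps K n]_n := \row_i fps_var i.

(* The composition f(g_1, ..., g_n).  It is meaningful only when every g_i     *)
(* has zero constant term: then g^k has no terms of degree < |k|, and the sum  *)
(* over |k| <= |m| is the full coefficient of x^m.                             *)
Definition fps_comp n p (f : fps K n) (g : 'rV[fps K p]_n) : fps K p :=
  Fps (fun m => \sum_(k : 'X_{1..n < (mdeg m).+1})
                  f k * (\prod_(i < n) g 0 i ^+ k i) m).

Definition map_comp n p q (F : 'rV[fps K n]_q) (g : 'rV[fps K p]_n) :
  'rV[fps K p]_q := map_mx (fun f => fps_comp f g) F.

Definition fps_deriv n (i : 'I_n) (f : fps K n) : fps K n :=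
  Fps (fun m => f (m + U_(i))%MM *+ (m i).+1).

Definition jacobian n q (F : 'rV[fps K n]_q) : 'M[fps K n]_(q, n) :=
  \matrix_(i, j) fps_deriv j (F 0 i).

Definition jacobian0 n q (F : 'rV[fps K n]_q) : 'M[K]_(q, n) :=
  map_mx (fun f : fps K n => f 0%MM) (jacobian F).

(* A formal map (K^n, 0) -> (K^q, 0). *)
Definition formal_map n q (F : 'rV[fps K n]_q) : Prop :=
  forall i, F 0 i 0%MM = 0.

(* Selections of rows or columns with repetitions only add zero minors; in     *)
(* particular no minor of size > n is nonzero.                                 *)
Definition nonzero_minor n q (A : 'M[fps K n]_(q, n)) (r : nat) : bool :=
  [exists a : {ffun 'I_r -> 'I_q}, exists b : {ffun 'I_r -> 'I_n},
     \det (mxsub a b A) != 0].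

Definition generic_rank n q (F : 'rV[fps K n]_q) : nat :=
  \max_(r < n.+1 | nonzero_minor (jacobian F) r) r.

Definition in_ideal n (r f : fps K n) : Prop := exists a, f = a * r.

Definition same_ideal n (r s : fps K n) : Prop :=
  forall f, in_ideal r f <-> in_ideal s f.

(* The coefficient of z^alpha in f(z, chi), as a power series in chi. *)
Definition coef_z n p (f : fps K (n + p)) (alpha : 'X_{1..n}) : fps K p :=
  Fps (fun beta : 'X_{1..p} =>
         f [multinom match split i with inl j => alpha j | inr j => beta j end
           | i < n + p]).

(* The map chi |-> (f_alpha(chi))_{|alpha| <= k}, for f = sum f_alpha z^alpha. *)
Definition coef_z_map n p (f : fps K (n + p)) (k : nat) :
    'rV[fps K p]_#|{: 'X_{1..n < k.+1}}| :=
  \row_i coef_z f (enum_val i : 'X_{1..n < k.+1}).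

End FpsCalculus.

Arguments fps_vars {K n}.

Section Hypersurfaces.
Variable C : numClosedFieldType.

Definition fps_conj n (f : fps C n) : fps C n := Fps (fun m => (f m)^*).

Definition map_conj n q (F : 'rV[fps C n]_q) : 'rV[fps C n]_q :=
  map_mx (@fps_conj n) F.

Definition invertible_map N (F : 'rV[fps C N]_N) : Prop :=
  formal_map F /\ \det (jacobian0 F) != 0.

(* The N + N variables of C[[Z, zeta]]. *)
Definition varZ N : 'rV[fps C (N + N)]_N := lsubmx fps_vars.
Definition varzeta N : 'rV[fps C (N + N)]_N := rsubmx fps_vars.

(* The complex gradient of r(Z, zeta) in Z at 0. *)
Definition dZ0 N (r : fps C (N + N)) : 'rV[C]_N :=
  \row_i fps_deriv (lshift N i) r 0%MM.

(* r is a defining function of a formal real hypersurface through 0 in C^N. *)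
Definition real_hypersurface N (r : fps C (N + N)) : Prop :=
  [/\ fps_comp (fps_conj r) (row_mx (varzeta N) (varZ N)) = r,
      r 0%MM = 0 & dZ0 r != 0].

Section NormalCoordinates.
Variable n : nat.

(* The variables of C[[z, w, chi, tau]], where C^(n+1) has coordinates (z, w). *)
Definition nz : 'rV[fps C ((n + 1) + (n + 1))]_n := lsubmx (varZ (n + 1)).
Definition nw : 'rV[fps C ((n + 1) + (n + 1))]_1 := rsubmx (varZ (n + 1)).
Definition nchi : 'rV[fps C ((n + 1) + (n + 1))]_n := lsubmx (varzeta (n + 1)).
Definition ntau : 'rV[fps C ((n + 1) + (n + 1))]_1 := rsubmx (varzeta (n + 1)).

(* The variables of C[[z, chi, tau]]. *)
Definition qz : 'rV[fps C (n + n + 1)]_n := lsubmx (lsubmx fps_vars).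
Definition qchi : 'rV[fps C (n + n + 1)]_n := rsubmx (lsubmx fps_vars).
Definition qtau : 'rV[fps C (n + n + 1)]_1 := rsubmx fps_vars.

(* Q(z, chi, tau) for series z, chi, tau without constant term. *)
Definition evalQ p (Q : fps C (n + n + 1)) (z chi : 'rV[fps C p]_n)
    (tau : 'rV[fps C p]_1) : fps C p :=
  fps_comp Q (row_mx (row_mx z chi) tau).

(* In the coordinates Z = phi(z, w), zeta = conj(phi)(chi, tau), the           *)
(* hypersurface defined by r is defined by w - Q(z, chi, tau).                 *)
Definition normal_coordinates (r : fps C ((n + 1) + (n + 1)))
    (phi : 'rV[fps C (n + 1)]_(n + 1)) (Q : fps C (n + n + 1)) : Prop :=
  [/\ invertible_map phi,
      evalQ Q 0 qchi qtau = qtau 0 0,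
      evalQ Q qz 0 qtau = qtau 0 0 &
      same_ideal
        (fps_comp r (row_mx (map_comp phi (varZ (n + 1)))
                            (map_comp (map_conj phi) (varzeta (n + 1)))))
        (nw 0 0 - evalQ Q nz nchi ntau)].

(* Q(z, chi, 0) in C[[z, chi]]. *)
Definition at_tau0 (Q : fps C (n + n + 1)) : fps C (n + n) :=
  evalQ Q (lsubmx fps_vars) (rsubmx fps_vars) 0.

(* r is of m-infinite type, as seen in the normal coordinates phi. *)
Definition m_infinite_type_in (m : nat) (r : fps C ((n + 1) + (n + 1)))
    (phi : 'rV[fps C (n + 1)]_(n + 1)) (Q Qt : fps C (n + n + 1)) : Prop :=
  normal_coordinates r phi Q /\
  [/\ Q = qtau 0 0 + qtau 0 0 ^+ m * Qt,
      evalQ Qt qz 0 qtau = 0,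
      evalQ Qt 0 qchi qtau = 0 &
      at_tau0 Qt != 0].

Definition class_C (m : nat) (r : fps C ((n + 1) + (n + 1))) : Prop :=
  exists phi Q Qt,
    m_infinite_type_in m r phi Q Qt /\
    exists k0 : nat, forall k : nat, (k0 <= k)%N ->
      generic_rank (coef_z_map (at_tau0 Qt) k) = n.

End NormalCoordinates.

Definition maps_into_itself N (r : fps C (N + N)) (H : 'rV[fps C N]_N) : Prop :=
  in_ideal r (fps_comp r (row_mx (map_comp H (varZ N))
                                 (map_comp (map_conj H) (varzeta N)))).

(* T^{1,0}_0 M + dH(T_0 C^N) = T_0 C^N.  Tangent vectors are row vectors and   *)
(* subspaces are row spaces, whence the transposes: kermx (dZ0 r)^T is the     *)
(* kernel of d_Z r(0), and the row space of (jacobian0 H)^T is the image of dH.*)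
Definition CR_transversal N (r : fps C (N + N)) (H : 'rV[fps C N]_N) : Prop :=
  row_full (kermx (dZ0 r)^T + (jacobian0 H)^T)%MS.

End Hypersurfaces.

(* Main.v *)
From HB Require Import structures.
From mathcomp Require Import all_boot all_order all_algebra.
From mathcomp Require Import mpoly complex boolp reals.
From mathcomp Require Import perm ring.
Require Import Defs.

(** In normal coordinates the invariance equation, restricted to [chi = 0] and
    conjugated, shows that the transversal component [G] of the map is
    [c w + O(w^2)] and that both its values [G(z, tau)] and [conj(G)(chi, tau)]
    agree modulo [tau^(m+1)].  Dividing the invariance equation by [tau^m] and
    setting [tau = 0] leaves [c Qt0(z, chi) = c^m Qt0(f(z), conj(f)(chi))], where
    [Qt0 = Qt(z, chi, 0)] and [f(z) = F(z, 0)].  Comparing coefficients of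
    [z^alpha], the family [W] of the [Qt_alpha(chi)] with [|alpha| <= k] satisfies
    [W = W(conj(f)) A] for a constant matrix [A].  If the Jacobian determinant of
    [conj(f)] vanished at 0, this relation would raise the order of the maximal
    minors of the Jacobian of [W] indefinitely, so they would all be zero,
    against the generic rank condition.  CR transversality gives [c <> 0], and
    the Jacobian matrix of the map at 0 is block triangular with diagonal blocks
    [df(0)] and [c]. *)

Set Implicit Arguments.
Unset Strict Implicit.
Unset Printing Implicit Defensive.

Import Order.TTheory GRing.Theory Num.Theory.
Local Open Scope ring_scope.


(** * Order of vanishing and monomials of formal power series *)

Section Order.
Variables (K : comNzRingType).

(** Only lower bounds on the order are recorded, so the zero series needs no infinite order. Series
    are proved equal by bounding the order of their difference by every [d]. *)
Definition ordge n (d : nat) (f : fps K n) :=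
  forall m, (mdeg m < d)%N -> f m = 0.

Definition monomial n (c : K) (k : 'X_{1..n}) : fps K n :=
  Fps (fun m => if m == k then c else 0).

Variable n : nat.
Implicit Types (f g h : fps K n) (m k : 'X_{1..n}) (d : nat).

Lemma fps0E m : (0 : fps K n) m = 0.
Proof. by rewrite /= if_same. Qed.

Lemma fpsDE f g m : (f + g) m = f m + g m. Proof. by []. Qed.

Lemma fpsNE f m : (- f) m = - f m. Proof. by []. Qed.

Lemma fpsBE f g m : (f - g) m = f m - g m. Proof. by []. Qed.

Lemma fps1E m : (1 : fps K n) m = if m == 0%MM then 1 else 0. Proof. by []. Qed.

Lemma fps_sumE (I : Type) (s : seq I) (P : pred I) (F : I -> fps K n) m :
  (\sum_(i <- s | P i) F i) m = \sum_(i <- s | P i) F i m.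
Proof.
elim/big_rec2: _ => [|i y x _ <-]; first exact: fps0E.
by rewrite fpsDE.
Qed.

Lemma fpsME f g m : (f * g) m =
  \sum_(k : 'X_{1..n < (mdeg m).+1} | (k <= m)%MM) f k * g (m - k)%MM.
Proof. by []. Qed.

Lemma fpsME0 f g : (f * g) 0%MM = f 0%MM * g 0%MM.
Proof.
rewrite fpsME (bigD1 (BMultinom (ltnSn (mdeg 0%MM)))) ?lepm_refl //=.
rewrite big1 ?addr0 => [|k /andP [k0 /eqP nk]].
  by congr (_ * g _); apply/mnmP => i; rewrite mnmBE mnm0E.
case: nk; apply: val_inj; apply/mnmP => i /=.
by move/mnm_lepP: k0 => /(_ i); rewrite mnm0E; case: (_ i).
Qed.

Definition fps_eval0 f : K := f 0%MM.

Fact fps_eval0_is_zmod : zmod_morphism fps_eval0.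
Proof. by []. Qed.
Fact fps_eval0_is_monoid : monoid_morphism fps_eval0.
Proof. by split=> [|f g]; rewrite /fps_eval0 ?fps1E ?eqxx ?fpsME0. Qed.
HB.instance Definition _ := GRing.isZmodMorphism.Build (fps K n) K
  fps_eval0 fps_eval0_is_zmod.
HB.instance Definition _ := GRing.isMonoidMorphism.Build (fps K n) K
  fps_eval0 fps_eval0_is_monoid.

Lemma ordge0 d : ordge d (0 : fps K n).
Proof. by move=> m _; rewrite fps0E. Qed.

Lemma ordgeD d f g : ordge d f -> ordge d g -> ordge d (f + g).
Proof. by move=> df dg m md; rewrite fpsDE df ?dg ?addr0. Qed.

Lemma ordgeN d f : ordge d f -> ordge d (- f).
Proof. by move=> df m md; rewrite fpsNE df ?oppr0. Qed.

Lemma ordgeB d f g : ordge d f -> ordge d g -> ordge d (f - g).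
Proof. by move=> df dg; apply: ordgeD => //; apply: ordgeN. Qed.

Lemma ordge_sum d (I : Type) (s : seq I) (P : pred I) (F : I -> fps K n) :
  (forall i, P i -> ordge d (F i)) -> ordge d (\sum_(i <- s | P i) F i).
Proof.
by move=> dF; elim/big_ind: _ => //; [exact: ordge0 | move=> *; exact: ordgeD].
Qed.

Lemma ordgeW d e f : (d <= e)%N -> ordge e f -> ordge d f.
Proof. by move=> de ef m md; apply: ef; apply: leq_trans de. Qed.

Lemma ordge_0 f : ordge 0 f.
Proof. by []. Qed.

Lemma ordge1P f : ordge 1 f <-> f 0%MM = 0.
Proof.
split=> [-> //|f0 m]; first by rewrite mdeg0.
by rewrite ltnS leqn0 mdeg_eq0 => /eqP ->.
Qed.

Lemma ordgeM d e f g : ordge d f -> ordge e g -> ordge (d + e) (f * g).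
Proof.
move=> df eg m md; rewrite fpsME big1 // => k km.
have [kd|kd] := ltnP (mdeg k) d; first by rewrite df ?mul0r.
rewrite eg ?mulr0 //.
have := mdegD (m - k)%MM k; rewrite submK // => em.
by rewrite em in md; rewrite -(ltn_add2r (mdeg k)) (leq_trans md) // addnC leq_add2l.
Qed.

Lemma ordgeMl d f g : ordge d f -> ordge d (f * g).
Proof. by move=> df; rewrite -[d]addn0; apply: ordgeM. Qed.

Lemma ordgeMr d f g : ordge d g -> ordge d (f * g).
Proof. by rewrite mulrC; apply: ordgeMl. Qed.

Lemma ordgeX d f : ordge 1 f -> ordge d (f ^+ d).
Proof. by move=> f1; elim: d => // d IH; rewrite exprS -add1n; apply: ordgeM. Qed.

Lemma ordge_eq f g : (forall d, ordge d (f - g)) -> f = g.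
Proof.
move=> fg; apply: fpsP => m; apply/eqP; rewrite -subr_eq0 -fpsBE.
by rewrite (fg (mdeg m).+1).
Qed.

Lemma ordge_prodB d (I : Type) (s : seq I) (P : pred I) (F G : I -> fps K n) :
  (forall i, P i -> ordge d (F i - G i)) ->
  ordge d (\prod_(i <- s | P i) F i - \prod_(i <- s | P i) G i).
Proof.
move=> dFG; elim/big_rec2: _ => [|i y x Pi IH]; first by rewrite subrr; apply: ordge0.
have -> : F i * x - G i * y = F i * (x - y) + (F i - G i) * y by ring.
by apply: ordgeD; [apply: ordgeMr | apply: ordgeMl; apply: dFG].
Qed.

Lemma ordge_expB d e f g : ordge d (f - g) -> ordge d (f ^+ e - g ^+ e).
Proof. by move=> dfg; rewrite subrXX; apply: ordgeMl. Qed.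

Lemma monomialE0 c k m : m != k -> monomial c k m = 0.
Proof. by rewrite /= => /negPf ->. Qed.

Lemma fps_const_monomial c : fps_const n c = monomial c 0.
Proof. by []. Qed.

Lemma fps_monomialM c k f m :
  (monomial c k * f) m = if (k <= m)%MM then c * f (m - k)%MM else 0.
Proof.
rewrite fpsME; case: ifP => km; last first.
  rewrite big1 // => j jm; rewrite monomialE0 ?mul0r //.
  by apply: contraFneq km => <-.
have lk : (mdeg k < (mdeg m).+1)%N by rewrite ltnS -(submK km) mdegD leq_addl.
rewrite (bigD1 (BMultinom lk)) //= eqxx big1 ?addr0 // => j /andP [_ jk].
by rewrite ifN ?mul0r.
Qed.

Lemma monomialM c1 c2 k1 k2 :
  monomial c1 k1 * monomial c2 k2 = monomial (c1 * c2) (k1 + k2)%MM.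
Proof.
apply: fpsP => m; rewrite fps_monomialM /=; case: ifP => km.
  have -> : (m - k1 == k2)%MM = (m == (k1 + k2)%MM).
    by apply/eqP/eqP => [<-|->]; rewrite 1?addmC ?submK // addmK.
  by case: ifP => // _; rewrite mulr0.
by case: eqP km => // ->; rewrite lem_addr.
Qed.

Lemma monomial_exp c k e : monomial c k ^+ e = monomial (c ^+ e) (k *+ e)%MM.
Proof.
elim: e => [|e IH]; first by rewrite mulm0n.
by rewrite exprS IH monomialM -exprS mulmS.
Qed.

Lemma monomial_prod k : monomial 1 k = \prod_(i < n) fps_var K i ^+ k i.
Proof.
have prodE (s : seq 'I_n) (c : 'I_n -> 'X_{1..n}) :
  \prod_(i <- s) monomial (1 : K) (c i) = monomial 1 (\sum_(i <- s) c i)%MM.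
  elim/big_rec2: _ => // i y x _ ->; by rewrite monomialM mulr1.
under eq_bigr => i _ do rewrite -/(monomial 1 U_(i)%MM) monomial_exp expr1n.
rewrite prodE; congr monomial; apply/mnmP => j; rewrite mnm_sumE (bigD1 j) //=.
rewrite mulmnE mnm1E eqxx mul1n big1 ?addn0 // => i ij.
by rewrite mulmnE mnm1E (negPf ij).
Qed.

Lemma monomial_const c k : monomial c k = fps_const n c * monomial 1 k.
Proof. by rewrite fps_const_monomial monomialM mulr1 add0m. Qed.

Definition fps_cut d f : fps K n := \sum_(k : 'X_{1..n < d}) monomial (f k) k.

Lemma fps_cutP d f : ordge d (f - fps_cut d f).
Proof.
move=> m md; rewrite fpsBE fps_sumE (bigD1 (BMultinom md)) //= eqxx.
rewrite big1 ?addr0 ?subrr // => k nk; rewrite ifN // eq_sym.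
by apply: contraNneq nk => e; apply/eqP/val_inj.
Qed.

End Order.

(** * Continuous additive maps, and extension of identities from monomials *)

Section Continuity.
Variables (K : comNzRingType) (n p : nat).

(** Continuity is meant for the topology defined by the order. The bound [d] may exceed [e], so that
    derivations and coefficient extractions, which lower the order, are included. *)
Definition continuous_additive (phi : fps K n -> fps K p) :=
  (forall f g, phi (f - g) = phi f - phi g) /\
  (forall e, exists d, forall f, ordge d f -> ordge e (phi f)).

Lemma continuous_additive_sum phi (I : Type) (s : seq I) (P : pred I) F :
  continuous_additive phi ->
  phi (\sum_(i <- s | P i) F i) = \sum_(i <- s | P i) phi (F i).
Proof.
case=> phiB _; have phi0 : phi 0 = 0 by rewrite -{1}(subrr 0) phiB subrr.
elim/big_rec2: _ => // i y x _ <-.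
have phiN u : phi (- u) = - phi u by rewrite -{1}(add0r (- u)) phiB phi0 add0r.
by rewrite -{1}(opprK x) phiB phiN opprK.
Qed.

(** Polynomials are dense: on the truncation [fps_cut d f] the two maps agree by additivity, and
    both send the remainder to a series of order at least [e] once [d] is large. *)
Lemma fps_ext phi psi : continuous_additive phi -> continuous_additive psi ->
  (forall c k, phi (monomial c k) = psi (monomial c k)) -> phi =1 psi.
Proof.
move=> cphi cpsi eq_mon f; apply: ordge_eq => e.
case: (cphi) (cpsi) => phiB /(_ e) [d1 phi1] [psiB /(_ e) [d2 psi2]].
pose d := maxn d1 d2; pose g := fps_cut d f.
have fg : ordge d (f - g) by apply: fps_cutP.
have -> : phi f - psi f = phi (f - g) - psi (f - g).
  rewrite phiB psiB !(continuous_additive_sum _ _ _ cphi, continuous_additive_sum _ _ _ cpsi).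
  under [in RHS]eq_bigr => k _ do rewrite eq_mon.
  by ring.
apply: ordgeB; [apply: phi1 | apply: psi2]; apply: ordgeW fg.
  exact: leq_maxl.
exact: leq_maxr.
Qed.

Lemma continuous_additiveD phi psi : continuous_additive phi ->
  continuous_additive psi -> continuous_additive (fun f => phi f + psi f).
Proof.
case=> phiB phiC [psiB psiC]; split=> [f g|e]; first by rewrite phiB psiB; ring.
have [d1 h1] := phiC e; have [d2 h2] := psiC e; exists (maxn d1 d2) => f fd.
by apply: ordgeD; [apply: h1 | apply: h2]; apply: ordgeW fd;
  rewrite ?leq_maxl ?leq_maxr.
Qed.

Lemma continuous_additive_mulr phi h : continuous_additive phi ->
  continuous_additive (fun f => phi f * h).
Proof.
case=> phiB phiC; split=> [f g|e]; first by rewrite phiB mulrBl.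
by have [d hd] := phiC e; exists d => f fd; apply: ordgeMl; apply: hd.
Qed.

Lemma continuous_additive_bigsum (I : Type) (s : seq I) (P : pred I)
    (phi : I -> fps K n -> fps K p) :
  (forall i, continuous_additive (phi i)) ->
  continuous_additive (fun f => \sum_(i <- s | P i) phi i f).
Proof.
move=> cphi; elim: s => [|i s IH].
  split=> [f g|e]; first by rewrite !big_nil subrr.
  by exists 0%N => f _; rewrite big_nil; apply: ordge0.
have [c|nc] := boolP (P i); last first.
  by under eq_fun => f do rewrite big_cons (negPf nc).
under eq_fun => f do rewrite big_cons c.
exact: continuous_additiveD.
Qed.

End Continuity.

Lemma continuous_additive_id (K : comNzRingType) n :
  continuous_additive (fun f : fps K n => f).
Proof. by split=> // e; exists e. Qed.

Lemma continuous_additive_comp (K : comNzRingType) n p q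
    (phi : fps K p -> fps K q) (psi : fps K n -> fps K p) :
  continuous_additive phi -> continuous_additive psi ->
  continuous_additive (fun f => phi (psi f)).
Proof.
case=> phiB phiC [psiB psiC]; split=> [f g|e]; first by rewrite psiB phiB.
have [d hd] := phiC e; have [d' hd'] := psiC d.
by exists d' => f /hd'; apply: hd.
Qed.

(** * Substitution of formal maps as a continuous ring morphism *)

Section Composition.
Variables (K : comNzRingType) (n p : nat) (g : 'rV[fps K p]_n).
Hypothesis g0 : formal_map g.
Implicit Types (f h : fps K n).

Definition mpow (k : 'X_{1..n}) : fps K p := \prod_(i < n) g 0 i ^+ k i.

Lemma mpowD k l : mpow (k + l)%MM = mpow k * mpow l.
Proof.
by rewrite -big_split; apply: eq_bigr => i _; rewrite mnmDE exprD.
Qed.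

Lemma mpow0 : mpow 0%MM = 1.
Proof. by rewrite /mpow big1 // => i _; rewrite mnm0E. Qed.

Lemma mpow1 i : mpow U_(i)%MM = g 0 i.
Proof.
rewrite /mpow (bigD1 i) //= mnm1E eqxx expr1 big1 ?mulr1 // => j ji.
by rewrite mnm1E eq_sym (negPf ji).
Qed.

Lemma ordge_mpow k : ordge (mdeg k) (mpow k).
Proof.
rewrite /mpow mdegE; elim/big_rec2: _ => // i y x _ yx; apply: ordgeM => //.
by apply: ordgeX; apply/ordge1P; apply: g0.
Qed.

Lemma fps_compE f m :
  fps_comp f g m = \sum_(k : 'X_{1..n < (mdeg m).+1}) f k * mpow k m.
Proof. by []. Qed.

Lemma fps_compB f h : fps_comp (f - h) g = fps_comp f g - fps_comp h g.
Proof.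
apply: fpsP => m; rewrite fpsBE !fps_compE -sumrB.
by apply: eq_bigr => k _; rewrite mulrBl.
Qed.

Lemma ordge_comp d f : ordge d f -> ordge d (fps_comp f g).
Proof.
move=> fd m md; rewrite fps_compE big1 // => k _; rewrite fd ?mul0r //.
by apply: leq_trans md; apply: bmdeg.
Qed.

Lemma continuous_additive_fps_comp : continuous_additive (fun f => fps_comp f g).
Proof. by split=> [f h|e]; [apply: fps_compB | exists e => f; apply: ordge_comp]. Qed.

Lemma fps_comp_monomial c k :
  fps_comp (monomial c k) g = fps_const p c * mpow k.
Proof.
apply: fpsP => m; rewrite fps_const_monomial fps_monomialM.
have -> : (0 <= m)%MM by apply/mnm_lepP => i; rewrite mnm0E.
rewrite subm0 fps_compE.
have [km|km] := ltnP (mdeg k) (mdeg m).+1.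
  rewrite (bigD1 (BMultinom km)) //= eqxx big1 ?addr0 // => l nl.
  rewrite ifN ?mul0r //; apply: contraNneq nl => e; exact/eqP/val_inj.
(* Here [k] lies outside the range of the sum that defines the composition; nothing is lost, because
   [mpow k] has order at least [mdeg k], which exceeds [mdeg m]. *)
rewrite (ordge_mpow km) mulr0 big1 // => l _; rewrite monomialE0 ?mul0r //.
by apply: contraTneq (bmdeg l) => ->; rewrite -leqNgt.
Qed.

Lemma fps_comp_const c : fps_comp (fps_const n c) g = fps_const p c.
Proof. by rewrite fps_const_monomial fps_comp_monomial mpow0 mulr1. Qed.

Lemma fps_comp_var i : fps_comp (fps_var K i) g = g 0 i.
Proof. by rewrite [fps_var K i]/(monomial 1 _) fps_comp_monomial mpow1 mul1r. Qed.

Lemma fps_comp1 : fps_comp 1 g = 1.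
Proof. exact: fps_comp_const. Qed.

(** Both sides are continuous and additive in each factor, so [fps_ext], applied once per factor,
    reduces the claim to monomials, where it is [mpowD]. *)
Lemma fps_compM f h : fps_comp (f * h) g = fps_comp f g * fps_comp h g.
Proof.
have cadd := continuous_additive_fps_comp; have cid := @continuous_additive_id K n.
move: f; apply: fps_ext => [||c k].
- by apply: (continuous_additive_comp cadd); apply: continuous_additive_mulr cid.
- exact: continuous_additive_mulr.
rewrite (mulrC _ h) (mulrC (fps_comp (monomial _ _) g)); move: h; apply: fps_ext => [||c' k'].
- by apply: (continuous_additive_comp cadd); apply: continuous_additive_mulr cid.
- exact: continuous_additive_mulr.
rewrite monomialM !fps_comp_monomial mpowD !fps_const_monomial.
rewrite -[0%MM in LHS]addm0 -monomialM.
by ring.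
Qed.

Lemma fps_comp0 : fps_comp 0 g = 0.
Proof. by rewrite -(subrr 0) fps_compB subrr. Qed.

Lemma fps_compN f : fps_comp (- f) g = - fps_comp f g.
Proof. by rewrite -[- f]add0r fps_compB fps_comp0 add0r. Qed.

Lemma fps_compD f h : fps_comp (f + h) g = fps_comp f g + fps_comp h g.
Proof. by rewrite -{1}[h]opprK fps_compB fps_compN opprK. Qed.

Lemma fps_compX f e : fps_comp (f ^+ e) g = fps_comp f g ^+ e.
Proof. by elim: e => [|e IH]; rewrite ?fps_comp1 // !exprS fps_compM IH. Qed.

(** This lemma and [fps_comp_linear_expansion] follow the shapes of [Q] and of the expansions of
    [G]; [fps_comp_const_addM] and [fps_comp_exp_constM] serve to set [tau = 0] in the divided
    invariance equation. *)
Lemma fps_comp_add_expM f h h' e : fps_comp (f + h ^+ e * h') g =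
  fps_comp f g + fps_comp h g ^+ e * fps_comp h' g.
Proof. by rewrite fps_compD fps_compM fps_compX. Qed.

Lemma fps_comp_linear_expansion c f h : fps_comp (fps_const n c * f + f ^+ 2 * h) g =
  fps_const p c * fps_comp f g + fps_comp f g ^+ 2 * fps_comp h g.
Proof. by rewrite fps_comp_add_expM fps_compM fps_comp_const. Qed.

Lemma fps_comp_const_addM c f t h : fps_comp t g = 0 ->
  fps_comp (fps_const n c * f + t * h) g = fps_const p c * fps_comp f g.
Proof.
by move=> t0; rewrite fps_compD !fps_compM fps_comp_const t0 mul0r addr0.
Qed.

Lemma fps_comp_exp_constM c e f t h : fps_comp t g = 0 ->
  fps_comp ((fps_const n c + t * h) ^+ e * f) g =
  fps_const p c ^+ e * fps_comp f g.
Proof.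
move=> t0; rewrite fps_compM fps_compX fps_compD fps_compM fps_comp_const t0.
by rewrite mul0r addr0.
Qed.

Lemma fps_comp_sum (I : Type) (s : seq I) (P : pred I) (F : I -> fps K n) :
  fps_comp (\sum_(i <- s | P i) F i) g = \sum_(i <- s | P i) fps_comp (F i) g.
Proof. exact: (continuous_additive_sum s P F continuous_additive_fps_comp). Qed.

Lemma fps_comp_prod (I : Type) (s : seq I) (P : pred I) (F : I -> fps K n) :
  fps_comp (\prod_(i <- s | P i) F i) g = \prod_(i <- s | P i) fps_comp (F i) g.
Proof. by elim/big_rec2: _ => [|i y x _ <-]; rewrite ?fps_comp1 ?fps_compM. Qed.

Lemma fps_comp_at0 f : fps_comp f g 0%MM = f 0%MM.
Proof.
have -> : f = fps_const n (f 0%MM) + (f - fps_const n (f 0%MM)) by ring.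
rewrite fps_compD fps_comp_const !fpsDE (_ : fps_comp (_ - _) g 0%MM = 0).
  by rewrite /= !eqxx subrr.
by apply/ordge1P/ordge_comp/ordge1P; rewrite /= eqxx subrr.
Qed.

Lemma map_comp_formal q (F : 'rV[fps K n]_q) : formal_map F ->
  formal_map (map_comp F g).
Proof. by move=> F0 i; rewrite mxE fps_comp_at0 F0. Qed.

End Composition.

Lemma fps_const_zmod (K : comNzRingType) n : zmod_morphism (@fps_const K n).
Proof. by move=> a b; apply: fpsP => m /=; case: ifP; rewrite ?subr0. Qed.
Lemma fps_const_monoid (K : comNzRingType) n : monoid_morphism (@fps_const K n).
Proof. by split=> // a b; rewrite !fps_const_monomial monomialM addm0. Qed.
HB.instance Definition _ (K : comNzRingType) n :=
  GRing.isZmodMorphism.Build K (fps K n) (@fps_const K n) (@fps_const_zmod K n).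
HB.instance Definition _ (K : comNzRingType) n :=
  GRing.isMonoidMorphism.Build K (fps K n) (@fps_const K n) (@fps_const_monoid K n).

Section CompositionTheory.
Variable K : comNzRingType.

Lemma fps_compA n p q (f : fps K n) (g : 'rV[fps K p]_n) (h : 'rV[fps K q]_p) :
  formal_map g -> formal_map h ->
  fps_comp (fps_comp f g) h = fps_comp f (map_comp g h).
Proof.
move=> g0 h0; have gh0 := map_comp_formal h0 g0.
have cg := continuous_additive_fps_comp g; have ch := continuous_additive_fps_comp h.
move: f; apply: fps_ext => [||c k].
- exact: (continuous_additive_comp ch cg).
- exact: continuous_additive_fps_comp.
rewrite !fps_comp_monomial // fps_compM // fps_comp_const // fps_comp_prod //.
by congr (_ * _); apply: eq_bigr => i _; rewrite fps_compX // mxE.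
Qed.

Lemma map_compA n p q s (F : 'rV[fps K n]_s) (g : 'rV[fps K p]_n)
    (h : 'rV[fps K q]_p) : formal_map g -> formal_map h ->
  map_comp (map_comp F g) h = map_comp F (map_comp g h).
Proof. by move=> g0 h0; apply/matrixP=> i j; rewrite !mxE fps_compA. Qed.

Lemma formal_map_vars n : formal_map (@fps_vars K n).
Proof.
by move=> i; rewrite mxE /= ifN // eq_sym mnm1_eq0.
Qed.

Lemma fps_comp_vars n (f : fps K n) : fps_comp f fps_vars = f.
Proof.
move: f; apply: fps_ext => [||c k].
- exact: continuous_additive_fps_comp.
- exact: continuous_additive_id.
rewrite fps_comp_monomial; last exact: formal_map_vars.
rewrite [RHS]monomial_const monomial_prod; congr (_ * _).
by apply: eq_bigr => i _; rewrite mxE.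
Qed.

Lemma map_comp_vars n q (F : 'rV[fps K n]_q) : map_comp F fps_vars = F.
Proof. by apply/matrixP => i j; rewrite mxE fps_comp_vars. Qed.

Lemma map_vars_comp n p (g : 'rV[fps K p]_n) : formal_map g ->
  map_comp fps_vars g = g.
Proof. by move=> g0; apply/rowP => i; rewrite !mxE fps_comp_var. Qed.

Lemma formal_map_row_mx n p q (F : 'rV[fps K n]_p) (G : 'rV[fps K n]_q) :
  formal_map F -> formal_map G -> formal_map (row_mx F G).
Proof. by move=> F0 G0 i; rewrite mxE; case: split. Qed.

Lemma formal_map_lsubmx n p q (F : 'rV[fps K n]_(p + q)) :
  formal_map F -> formal_map (lsubmx F).
Proof. by move=> F0 i; rewrite mxE. Qed.

Lemma formal_map_rsubmx n p q (F : 'rV[fps K n]_(p + q)) :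
  formal_map F -> formal_map (rsubmx F).
Proof. by move=> F0 i; rewrite mxE. Qed.

Lemma formal_map0 n p : formal_map (0 : 'rV[fps K n]_p).
Proof. by move=> i; rewrite mxE fps0E. Qed.

Lemma map_comp0 n p q (g : 'rV[fps K p]_n) :
  map_comp (0 : 'rV[fps K n]_q) g = 0.
Proof. by apply/rowP => i; rewrite !mxE fps_comp0. Qed.

Lemma map_comp_row_mx n p q s (F : 'rV[fps K n]_p) (G : 'rV[fps K n]_q)
    (g : 'rV[fps K s]_n) :
  map_comp (row_mx F G) g = row_mx (map_comp F g) (map_comp G g).
Proof. exact: map_row_mx. Qed.

Lemma map_comp_lsubmx n p q s (F : 'rV[fps K n]_(p + q)) (g : 'rV[fps K s]_n) :
  map_comp (lsubmx F) g = lsubmx (map_comp F g).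
Proof. by rewrite /map_comp map_lsubmx. Qed.

Lemma map_comp_rsubmx n p q s (F : 'rV[fps K n]_(p + q)) (g : 'rV[fps K s]_n) :
  map_comp (rsubmx F) g = rsubmx (map_comp F g).
Proof. by rewrite /map_comp map_rsubmx. Qed.

Lemma map_lvars_comp n p q (A : 'rV[fps K q]_n) (B : 'rV[fps K q]_p) :
  formal_map A -> formal_map B -> map_comp (lsubmx fps_vars) (row_mx A B) = A.
Proof.
move=> A0 B0; rewrite map_comp_lsubmx map_vars_comp ?row_mxKl //.
exact: formal_map_row_mx.
Qed.

Lemma map_rvars_comp n p q (A : 'rV[fps K q]_n) (B : 'rV[fps K q]_p) :
  formal_map A -> formal_map B -> map_comp (rsubmx fps_vars) (row_mx A B) = B.
Proof.
move=> A0 B0; rewrite map_comp_rsubmx map_vars_comp ?row_mxKr //.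
exact: formal_map_row_mx.
Qed.

End CompositionTheory.

(** * Partial derivatives, the product rule and the chain rule *)

Section Derivation.
Variable K : comNzRingType.

Lemma continuous_additive_deriv n (j : 'I_n) :
  continuous_additive (fun f : fps K n => fps_deriv j f).
Proof.
split=> [f g|e]; first by apply: fpsP => m; rewrite /= mulrnBl.
exists e.+1 => f fe m me; rewrite /= fe ?mul0rn //.
by rewrite mdegD mdeg1 addn1 ltnS.
Qed.

Lemma fps_deriv_monomial n (j : 'I_n) (c : K) k :
  fps_deriv j (monomial c k) = monomial (c *+ k j) (k - U_(j))%MM.
Proof.
apply: fpsP => m /=; have [e|ne] := eqVneq (m + U_(j))%MM k.
  rewrite -e addmK eqxx; congr (_ *+ _).
  by rewrite mnmDE mnm1E eqxx addn1.
rewrite mul0rn; case: eqP => // e; case kj: (k j) => [|a]; first by rewrite mulr0n.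
case/eqP: ne; rewrite e submK //; apply/mnm_lepP => i; rewrite mnm1E.
by case: eqP => // <-; rewrite kj.
Qed.

Lemma fps_derivM n (j : 'I_n) (f g : fps K n) :
  fps_deriv j (f * g) = fps_deriv j f * g + f * fps_deriv j g.
Proof.
have cD := continuous_additive_deriv j.
have cid := @continuous_additive_id K n.
move: f; apply: fps_ext => [||c k].
- by apply: (continuous_additive_comp cD); apply: continuous_additive_mulr cid.
- by apply: continuous_additiveD; apply: continuous_additive_mulr.
rewrite mulrC [X in _ = X + _]mulrC [X in _ = _ + X]mulrC.
move: g; apply: fps_ext => [||c' k'].
- by apply: (continuous_additive_comp cD); apply: continuous_additive_mulr cid.
- by apply: continuous_additiveD; apply: continuous_additive_mulr.
rewrite monomialM !fps_deriv_monomial !monomialM.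
(* Subtraction of exponents is truncated, so it commutes with adding [a] only if [b j] is positive;
   when [b j = 0] both coefficients vanish. *)
have shift (a b : 'X_{1..n}) (u v : K) :
  monomial (u * (v *+ b j)) (a + (b - U_(j)))%MM =
  monomial (u * v *+ b j) (a + b - U_(j))%MM.
  rewrite mulrnAr; case bj: (b j) => [|e].
    by rewrite !mulr0n; apply: fpsP => m /=; rewrite !if_same.
  congr monomial; apply/mnmP => i; rewrite !(mnmDE, mnmBE) mnm1E addnBA //.
  by case: eqP => // <-; rewrite bj.
rewrite shift [(k' - _ + k)%MM]addmC [_ *+ _ * c]mulrC shift.
rewrite [(k + k')%MM]addmC [c * c']mulrC mnmDE mulrnDr.
by apply: fpsP => m /=; case: ifP; rewrite ?addr0 // addrC.
Qed.

Lemma fps_deriv_const n (j : 'I_n) (c : K) : fps_deriv j (fps_const n c) = 0.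
Proof.
rewrite fps_const_monomial fps_deriv_monomial mnm0E mulr0n.
by apply: fpsP => m /=; rewrite !if_same.
Qed.

Lemma fps_deriv_var n (i j : 'I_n) : fps_deriv j (fps_var K i) = (i == j)%:R.
Proof.
rewrite [fps_var K i]/(monomial 1 _) fps_deriv_monomial mnm1E.
case: eqP => [->|_]; last by rewrite mulr0n; apply: fpsP => m /=; rewrite !if_same.
by rewrite (_ : (_ - _)%MM = 0%MM) //; apply/mnmP => l; rewrite mnmBE subnn mnm0E.
Qed.

Lemma fps_deriv_comp n p (f : fps K n) (g : 'rV[fps K p]_n) (j : 'I_p) :
  formal_map g ->
  fps_deriv j (fps_comp f g) =
  \sum_(i < n) fps_comp (fps_deriv i f) g * fps_deriv j (g 0 i).
Proof.
move=> g0; have cg := continuous_additive_fps_comp g.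
move: f; apply: fps_ext => [||c k].
- exact/(continuous_additive_comp _ cg)/continuous_additive_deriv.
- apply: continuous_additive_bigsum => i; apply: continuous_additive_mulr.
  exact/(continuous_additive_comp cg)/continuous_additive_deriv.
(* The series that obey the chain rule are closed under products and contain constants and
   variables, hence all monomials; continuity has reduced the lemma to these. *)
pose good f := fps_deriv j (fps_comp f g) =
  \sum_(i < n) fps_comp (fps_deriv i f) g * fps_deriv j (g 0 i).
have goodM f h : good f -> good h -> good (f * h).
  rewrite /good fps_compM // fps_derivM => -> ->.
  rewrite mulr_suml mulr_sumr -big_split; apply: eq_bigr => i _ /=.
  by rewrite fps_derivM fps_compD !fps_compM //; ring.
have good_const b : good (fps_const n b).
  rewrite /good fps_comp_const // fps_deriv_const big1 // => i _.
  by rewrite fps_deriv_const fps_comp0 mul0r.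
have good_var i : good (fps_var K i).
  rewrite /good fps_comp_var // (bigD1 i) //= fps_deriv_var eqxx fps_comp1 // mul1r.
  rewrite big1 ?addr0 // => l li; rewrite fps_deriv_var eq_sym (negPf li).
  by rewrite fps_comp0 mul0r.
rewrite -/(good _) monomial_const monomial_prod; apply: (goodM _ _ (good_const c)).
elim/big_ind: _ => [||i _]; [exact: good_const | exact: goodM |].
elim: (k i) => [|e IH]; first exact: good_const.
by rewrite exprS; apply: goodM.
Qed.

Lemma jacobian_comp n p q (F : 'rV[fps K n]_q) (g : 'rV[fps K p]_n) :
  formal_map g ->
  jacobian (map_comp F g) =
  map_mx (fun f => fps_comp f g) (jacobian F) *m jacobian g.
Proof.
move=> g0; apply/matrixP => i j; rewrite !mxE fps_deriv_comp //.
by apply: eq_bigr => l _; rewrite !mxE.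
Qed.

Lemma jacobian0_comp n p q (F : 'rV[fps K n]_q) (g : 'rV[fps K p]_n) :
  formal_map g -> jacobian0 (map_comp F g) = jacobian0 F *m jacobian0 g.
Proof.
move=> g0; rewrite /jacobian0 jacobian_comp //.
rewrite (map_mxM (@fps_eval0 K p)); congr (_ *m _).
by apply/matrixP => i j; rewrite !mxE; apply: fps_comp_at0.
Qed.

Lemma jacobian0E n q (F : 'rV[fps K n]_q) i j : jacobian0 F i j = F 0 i U_(j)%MM.
Proof. by rewrite !mxE /= mnm0E add0m. Qed.

End Derivation.

Lemma fps_mul_constr (K : comNzRingType) n (f : fps K n) c m :
  (f * fps_const n c) m = f m * c.
Proof.
rewrite mulrC fps_const_monomial fps_monomialM subm0 mulrC.
by rewrite (_ : (0 <= m)%MM = true) //; apply/mnm_lepP => i; rewrite mnm0E.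
Qed.

(** * The formal inverse function theorem by successive approximation *)

Section FormalInverse.
Variable K : comNzRingType.

Lemma ordge_mpowB n p d (g g' : 'rV[fps K p]_n) k :
  (forall i, ordge d (g 0 i - g' 0 i)) -> ordge d (mpow g k - mpow g' k).
Proof. by move=> dg; apply: ordge_prodB => i _; apply: ordge_expB. Qed.

(** The contraction estimate: every monomial of [h] has degree at least 2, so after one factor is
    replaced another factor without constant term remains, and the order of the difference grows by
    one. *)
Lemma ordge_comp_contract n p d (h : fps K n) (g g' : 'rV[fps K p]_n) :
  ordge 2 h -> formal_map g -> formal_map g' ->
  (forall i, ordge d (g 0 i - g' 0 i)) ->
  ordge d.+1 (fps_comp h g - fps_comp h g').
Proof.
move=> h2 g0 g'0 dg m md; rewrite fpsBE !fps_compE -sumrB big1 // => k _.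
rewrite -mulrBr -fpsBE; have [k2|k2] := ltnP (mdeg k) 2; first by rewrite h2 ?mul0r.
have [i ki|k0] := pickP (fun i => k i != 0%N); last first.
  move: k2; suff -> : (k : 'X_{1..n}) = 0%MM by rewrite mdeg0.
  by apply/mnmP => i; rewrite mnm0E; apply/eqP; rewrite -[_ == _]negbK k0.
pose l := (k - U_(i))%MM.
have kE : (k : 'X_{1..n}) = (U_(i) + l)%MM.
  rewrite addmC submK //; apply/mnm_lepP => j; rewrite mnm1E.
  by case: eqP => // <-; rewrite lt0n.
have l1 : (1 <= mdeg l)%N by move: k2; rewrite kE mdegD mdeg1.
suff : ordge d.+1 (mpow g k - mpow g' k) by move=> ->; rewrite ?mulr0.
have -> : mpow g k - mpow g' k =
  g 0 i * (mpow g l - mpow g' l) + (g 0 i - g' 0 i) * mpow g' l.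
  by rewrite kE !mpowD !mpow1; ring.
apply: ordgeD.
  by rewrite -add1n; apply: ordgeM; [apply/ordge1P/g0 | apply: ordge_mpowB].
rewrite -addn1; apply: ordgeM; first exact: dg.
exact: (ordgeW l1 (@ordge_mpow _ _ _ _ g'0 l)).
Qed.

(** The iterates [s k] of [g |-> T + h(g)] starting from 0 form a Cauchy sequence, since each
    iteration gains one order of agreement; their limit is the fixed point. *)
Lemma formal_fixpoint n p (h : 'rV[fps K n]_n) (T : 'rV[fps K p]_n) :
  (forall i, ordge 2 (h 0 i)) -> formal_map T ->
  exists2 g, formal_map g & g = T + map_comp h g.
Proof.
move=> h2 T0; pose s := fix s k := if k is e.+1 then T + map_comp h (s e) else 0.
have h_formal : formal_map h by move=> i; apply: h2; rewrite mdeg0.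
have s0 k : formal_map (s k).
  elim: k => [|k IH] /=; first exact: formal_map0.
  by move=> i; rewrite mxE fpsDE T0 add0r; apply: map_comp_formal.
have step k i : ordge k (s k.+1 0 i - s k 0 i).
  elim: k i => [|k IH] i; first exact: ordge_0.
  rewrite [s k.+2]/= [s k.+1 in X in _ - X]/=.
  rewrite !mxE addrAC opprD addrA subrr add0r addrC.
  exact: (ordge_comp_contract (h2 i) (s0 k.+1) (s0 k) IH).
have stepD k e i : ordge k (s (k + e)%N 0 i - s k 0 i).
  elim: e => [|e IH]; first by rewrite addn0 subrr; apply: ordge0.
  rewrite addnS -(subrKA (s (k + e)%N 0 i)); apply: ordgeD => //.
  by apply: ordgeW (step _ _); apply: leq_addr.
(* Consecutive iterates agree in degrees below [k] from [s k] on, so a coefficient of degree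
   [mdeg m] is stable from the iterate [(mdeg m).+1] on. *)
pose g : 'rV[fps K p]_n := \row_i Fps (fun m => s (mdeg m).+1 0 i m).
have gs k i : ordge k (g 0 i - s k 0 i).
  move=> m mk; rewrite fpsBE mxE /=.
  have := stepD (mdeg m).+1 (k - (mdeg m).+1)%N i m (ltnSn _).
  by rewrite fpsBE subnKC // => /subr0_eq ->; rewrite subrr.
have g0 : formal_map g.
  move=> i; have := gs 1%N i 0%MM; rewrite mdeg0 fpsBE => /(_ isT).
  by rewrite s0 subr0.
exists g => //; apply/rowP => i; apply: ordge_eq => d.
have -> : g 0 i - (T + map_comp h g) 0 i =
  (g 0 i - s d.+1 0 i) - (fps_comp (h 0 i) g - fps_comp (h 0 i) (s d)).
  by rewrite [s d.+1]/= !mxE; ring.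
apply: ordgeB; first by apply: ordgeW (gs _ _).
apply: ordgeW (ordge_comp_contract (h2 i) g0 (s0 d) (gs d)) => //.
Qed.

End FormalInverse.

(** Multiplication by the inverse linear part turns [phi] into the identity minus a map [h] of order
    at least 2, and [phi(g) = T] into the fixed point equation for [h] and the normalized [T]. Maps
    are row vectors acted on from the right, whence the transposed Jacobian. *)
Lemma formal_solve (K : fieldType) n p (phi : 'rV[fps K n]_n) (T : 'rV[fps K p]_n) :
  formal_map phi -> \det (jacobian0 phi) != 0 -> formal_map T ->
  exists2 g, formal_map g & map_comp phi g = T.
Proof.
move=> phi0 dphi T0.
pose J := jacobian0 phi.
have uJ : J^T \in unitmx by rewrite unitmx_tr unitmxE unitfE.
pose L : 'M[fps K n]_n := map_mx (fps_const n) (invmx J^T).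
pose L' : 'M[fps K p]_n := map_mx (fps_const p) (invmx J^T).
have L'K : cancel (mulmx^~ L' : 'rV_n -> 'rV_n) (mulmx^~ (map_mx (fps_const p) J^T)).
  by move=> X; rewrite -mulmxA -map_mxM mulVmx // map_mx1 mulmx1.
have compL (F : 'rV[fps K n]_n) (g : 'rV[fps K p]_n) :
    formal_map g -> map_comp (F *m L) g = map_comp F g *m L'.
  move=> g0; apply/rowP => j; rewrite !mxE fps_comp_sum.
  by apply: eq_bigr => i _; rewrite fps_compM // !mxE fps_comp_const.
have formalL q (F : 'rV[fps K q]_n) (A : 'M[K]_n) :
    formal_map F -> formal_map (F *m map_mx (fps_const q) A).
  move=> F0 j; rewrite mxE fps_sumE big1 // => i _.
  by rewrite fpsME0 F0 mul0r.
pose h := fps_vars - phi *m L.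
have h2 i : ordge 2 (h 0 i).
  move=> m; rewrite ltnS leq_eqVlt ltnS leqn0 mdeg_eq0 => /orP [|/eqP ->]; last first.
    rewrite (_ : h 0 i = fps_vars 0 i - (phi *m L) 0 i); last by rewrite !mxE.
    by rewrite fpsBE formal_map_vars formalL ?subrr.
  case/mdeg1P => j /eqP ->.
  have -> : h 0 i U_(j)%MM = (1%:M - J^T *m invmx J^T) j i; last first.
    by rewrite mulmxV // subrr mxE.
  rewrite !mxE fpsBE fps_sumE.
  congr (_ - _); first by rewrite /= eq_mnm1; case: eqP.
  by apply: eq_bigr => k _; rewrite !mxE fps_mul_constr -jacobian0E !mxE.
have [g g0 gE] := formal_fixpoint h2 (formalL _ _ (invmx J^T) T0).
exists g => //.
apply: (can_inj L'K); rewrite -compL //.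
have : map_comp h g = g - map_comp (phi *m L) g.
  rewrite -[in X in _ = X - _](map_vars_comp g0).
  by apply/rowP => i; rewrite /h !mxE fps_compB.
move=> hE; move: gE; rewrite hE => gE.
have := congr1 (fun X => X - g + map_comp (phi *m L) g) gE => /=.
by rewrite subrr add0r => ->; rewrite addrA addrAC addrK -addrA addNr addr0.
Qed.

(** * Series in two groups of variables and their coefficients in the first group *)

Section SplitVariables.
Variables (K : comNzRingType) (n p : nat).

Definition mjoin (a : 'X_{1..n}) (b : 'X_{1..p}) : 'X_{1..n + p} :=
  [multinom match split i with inl j => a j | inr j => b j end | i < n + p].

Definition mleft (m : 'X_{1..n + p}) : 'X_{1..n} := [multinom m (lshift p i) | i < n].

Definition mright (m : 'X_{1..n + p}) : 'X_{1..p} := [multinom m (rshift n i) | i < p].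

Let split_lshift (i : 'I_n) : split (lshift p i) = inl i.
Proof. exact: (unsplitK (inl i)). Qed.

Let split_rshift (i : 'I_p) : split (rshift n i) = inr i.
Proof. exact: (unsplitK (inr i)). Qed.

Lemma mjoinK m : mjoin (mleft m) (mright m) = m.
Proof.
apply/mnmP => i; rewrite mnmE; case: split_ordP => j ->; by rewrite mnmE.
Qed.

Lemma mleft_join a b : mleft (mjoin a b) = a.
Proof. by apply/mnmP => i; rewrite !mnmE split_lshift. Qed.

Lemma mright_join a b : mright (mjoin a b) = b.
Proof. by apply/mnmP => i; rewrite !mnmE split_rshift. Qed.

Lemma eq_mjoin a b a' b' : (mjoin a b == mjoin a' b') = (a == a') && (b == b').
Proof.
apply/eqP/andP => [e|[/eqP -> /eqP -> //]].
by rewrite -{1}(mleft_join a b) e mleft_join -{1}(mright_join a b) e mright_join.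
Qed.

Lemma mdeg_join a b : mdeg (mjoin a b) = (mdeg a + mdeg b)%N.
Proof.
rewrite !mdegE big_split_ord; congr addn; apply: eq_bigr => i _;
by rewrite mnmE (split_lshift, split_rshift).
Qed.

Lemma mpow_row_mx q (A : 'rV[fps K q]_n) (B : 'rV[fps K q]_p) m :
  mpow (row_mx A B) m = mpow A (mleft m) * mpow B (mright m).
Proof.
rewrite /mpow big_split_ord; congr (_ * _); apply: eq_bigr => i _;
by rewrite mnmE (row_mxEl, row_mxEr).
Qed.

Lemma mpow0r q (k : 'X_{1..p}) : mpow (0 : 'rV[fps K q]_p) k = (k == 0%MM)%:R.
Proof.
have [->|k0] := eqVneq k 0%MM; first by rewrite mpow0.
case: (pickP (fun i => k i != 0%N)) => [i ki|k_eq0].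
  by rewrite /mpow (bigD1 i) //= mxE expr0n (negPf ki) mul0r.
case/eqP: k0; apply/mnmP => i; rewrite mnm0E.
by apply/eqP; rewrite -[_ == _]negbK k_eq0.
Qed.

Lemma mpow_vars q (k : 'X_{1..q}) : mpow (@fps_vars K q) k = monomial 1 k.
Proof. by rewrite monomial_prod; apply: eq_bigr => i _; rewrite mxE. Qed.

(** Only exponents whose right part is zero survive, as [0 ^+ 0 = 1] and all other powers of 0
    vanish. *)
Lemma fps_comp_right0 (f : fps K (n + p)) a :
  fps_comp f (row_mx fps_vars 0) a = f (mjoin a 0).
Proof.
have zE k : mpow (row_mx fps_vars 0) k a = (k == mjoin a 0)%:R :> K.
  rewrite mpow_row_mx mpow0r mpow_vars -{3}(mjoinK k) eq_mjoin.
  case: (mright k == 0%MM); last by rewrite mulr0 andbF fps0E.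
  by rewrite mulr1 andbT /= [a == _]eq_sym; case: eqP.
rewrite fps_compE.
have lta : (mdeg (mjoin a 0) < (mdeg a).+1)%N by rewrite mdeg_join mdeg0 addn0.
rewrite (bigD1 (BMultinom lta)) //= zE eqxx mulr1 big1 ?addr0 // => k nk.
rewrite zE; case: eqP => [e|_]; last by rewrite mulr0.
by case/eqP: nk; apply: val_inj.
Qed.

Lemma coef_zE (f : fps K (n + p)) a b : coef_z f a b = f (mjoin a b).
Proof. by []. Qed.

Lemma continuous_additive_coef_z a :
  continuous_additive (fun f : fps K (n + p) => coef_z f a).
Proof.
split=> [f g|e]; first by apply: fpsP.
by exists (mdeg a + e)%N => f fe b be; rewrite coef_zE fe // mdeg_join ltn_add2l.
Qed.

Lemma coef_z_monomial c k a : coef_z (monomial c k : fps K (n + p)) a =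
  (a == mleft k)%:R * monomial c (mright k).
Proof.
apply: fpsP => b; rewrite mulr_natl mulrb coef_zE -{1}(mjoinK k) /= eq_mjoin.
by case: (a == _); rewrite ?fps0E.
Qed.

Lemma coef_zZ (c : K) (f : fps K (n + p)) a :
  coef_z (fps_const _ c * f) a = fps_const _ c * coef_z f a.
Proof.
apply: fpsP => b; rewrite coef_zE (mulrC _ f) (mulrC _ (coef_z f a)).
by rewrite !fps_mul_constr coef_zE.
Qed.

Definition lvars : 'rV[fps K (n + p)]_n := lsubmx fps_vars.
Definition rvars : 'rV[fps K (n + p)]_p := rsubmx fps_vars.

Lemma lvars_formal : formal_map lvars.
Proof. exact/formal_map_lsubmx/formal_map_vars. Qed.

Lemma rvars_formal : formal_map rvars.
Proof. exact/formal_map_rsubmx/formal_map_vars. Qed.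

Lemma mpow_lrvars k l : mpow lvars k * mpow rvars l = monomial 1 (mjoin k l).
Proof.
rewrite -mpow_vars -(hsubmxK (@fps_vars K (n + p))) mpow_row_mx.
by rewrite mleft_join mright_join.
Qed.

Lemma coef_z_prod (a : fps K n) (b : fps K p) (alpha : 'X_{1..n}) :
  coef_z (fps_comp a lvars * fps_comp b rvars) alpha = fps_const p (a alpha) * b.
Proof.
have cz := continuous_additive_coef_z alpha.
have cl := continuous_additive_fps_comp lvars.
have cr := continuous_additive_fps_comp rvars.
move: a; apply: fps_ext => [||c k].
- exact: (continuous_additive_comp cz (continuous_additive_mulr _ cl)).
- apply: continuous_additive_mulr; split=> [f g|e]; first by rewrite fpsBE raddfB.
  exists (mdeg alpha).+1 => f fa; rewrite (fa alpha) // raddf0; exact: ordge0.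
rewrite (mulrC (fps_comp _ lvars)) (mulrC (fps_const p _)).
move: b; apply: fps_ext => [||c' k'].
- exact: (continuous_additive_comp cz (continuous_additive_mulr _ cr)).
- exact: (continuous_additive_mulr _ (@continuous_additive_id _ _)).
rewrite !fps_comp_monomial; try by [exact: lvars_formal | exact: rvars_formal].
have -> : fps_const _ c' * mpow rvars k' * (fps_const _ c * mpow lvars k) =
   fps_const (n + p) (c' * c) * (mpow lvars k * mpow rvars k').
  by rewrite rmorphM; ring.
rewrite mpow_lrvars -monomial_const coef_z_monomial mleft_join mright_join.
rewrite /= mulrC; case: eqP => _; last by rewrite raddf0 !mulr0.
by rewrite mulr1 mulrC [in RHS]fps_const_monomial mulrC monomialM addm0.
Qed.

(** Since [F] has no constant term, [F^beta] has order at least [|beta|], so only indices with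
    [|beta| <= |alpha| < d] contribute. This finiteness is what lets the family of the [Qt_alpha]
    with [|alpha| <= k] be related to itself by a finite constant matrix. *)
Lemma coef_z_comp d (Q : fps K (n + p)) (F : 'rV[fps K n]_n) (G : 'rV[fps K p]_p)
    (alpha : 'X_{1..n}) : formal_map F -> formal_map G -> (mdeg alpha < d)%N ->
  coef_z (fps_comp Q (row_mx (map_comp F lvars) (map_comp G rvars))) alpha =
  \sum_(beta : 'X_{1..n < d})
     fps_comp (coef_z Q beta) G * fps_const p (mpow F beta alpha).
Proof.
move=> F0 G0 ad.
have Fl := map_comp_formal lvars_formal F0.
have Gr := map_comp_formal rvars_formal G0.
move: Q; apply: fps_ext => [||c k].
- exact: (continuous_additive_comp (continuous_additive_coef_z alpha)
    (continuous_additive_fps_comp _)).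
- apply: continuous_additive_bigsum => beta; apply: continuous_additive_mulr.
  exact: (continuous_additive_comp (continuous_additive_fps_comp _)
    (continuous_additive_coef_z _)).
rewrite fps_comp_monomial; last exact: formal_map_row_mx.
rewrite mpow_row_mx.
have mpow_map q s t (A : 'rV[fps K q]_s) (g : 'rV[fps K t]_q) l :
    formal_map g -> mpow (map_comp A g) l = fps_comp (mpow A l) g.
  move=> g0; rewrite /mpow fps_comp_prod //; apply: eq_bigr => i _.
  by rewrite mxE fps_compX.
rewrite !mpow_map; try by [exact: lvars_formal | exact: rvars_formal].
rewrite mulrA -(fps_comp_const lvars_formal) -fps_compM; last exact: lvars_formal.
rewrite coef_z_prod [fps_const n c * _]mulrC fps_mul_constr.
under eq_bigr => beta _ do rewrite coef_z_monomial.
have [kd|kd] := ltnP (mdeg (mleft k)) d; last first.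
  have -> : mpow F (mleft k) alpha = 0.
    by rewrite (ordge_mpow F0) // (leq_trans ad).
  rewrite mul0r raddf0 mul0r big1 // => beta _.
  have -> : ((beta : 'X_{1..n}) == mleft k) = false.
    by apply: contraTF (bmdeg beta) => /eqP ->; rewrite -leqNgt.
  by rewrite mul0r fps_comp0 mul0r.
rewrite (bigD1 (BMultinom kd)) //= eqxx mul1r fps_comp_monomial //.
rewrite big1 => [|beta nb]; first by rewrite addr0 rmorphM; ring.
case: eqP => [e|_]; last by rewrite mul0r fps_comp0 mul0r.
by case/eqP: nb; apply: val_inj.
Qed.

End SplitVariables.

(** * Division by a variable and divisibility of differences *)

Section Division.
Variables (K : comNzRingType) (n : nat).

Lemma fps_varM i (f : fps K n) m :
  (fps_var K i * f) m = if (U_(i) <= m)%MM then f (m - U_(i))%MM else 0.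
Proof. by rewrite [fps_var K i]/(monomial 1 _) fps_monomialM mul1r. Qed.

Lemma fps_var_lreg i (f g : fps K n) : fps_var K i * f = fps_var K i * g -> f = g.
Proof.
move=> fg; apply: fpsP => m; have := congr1 (fun h : fps K n => h (m + U_(i))%MM) fg.
by rewrite !fps_varM lem_addl addmK.
Qed.

Lemma fps_var_exp_lreg i e (f g : fps K n) :
  fps_var K i ^+ e * f = fps_var K i ^+ e * g -> f = g.
Proof.
by elim: e => [|e IH]; rewrite ?mul1r // exprS -!mulrA => /fps_var_lreg.
Qed.

End Division.

Section DivisionByLast.
Variables (K : comNzRingType) (n : nat).

Definition fps_last : fps K (n + 1) := fps_var K (rshift n ord0).

(** The restriction to the hyperplane where the last variable is 0 carries exactly the coefficients
    of the monomials free of that variable. *)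
Lemma fps_divides_last (f : fps K (n + 1)) :
  fps_comp f (row_mx fps_vars 0) = 0 -> exists g, f = fps_last * g.
Proof.
move=> f0; exists (Fps (fun m => f (m + U_(rshift n ord0))%MM)).
apply: fpsP => m; rewrite [RHS]fps_varM /=; case: ifP => um; first by rewrite submK.
have m0 : mright m = 0%MM.
  apply/mnmP => i; rewrite mnmE mnm0E ord1; apply/eqP; apply: contraFT um => mi.
  by apply/mnm_lepP => j; rewrite mnm1E; case: eqP => // <-; rewrite lt0n.
rewrite -(mjoinK m) m0 -fps_comp_right0 f0.
exact: fps0E.
Qed.

End DivisionByLast.

Section Difference.
Variables (K : comNzRingType) (n : nat).

(** The generic difference [f(z, w + t) - f(z, w)], in independent variables, vanishes at [t = 0]
    and is thus divisible by [t]; substituting [z = A], [w = b'], [t = b - b'] gives the general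
    case. *)
Lemma fps_comp_sub_divides q (f : fps K (n + 1)) (A : 'rV[fps K q]_n)
    (b b' : 'rV[fps K q]_1) : formal_map A -> formal_map b -> formal_map b' ->
  exists h, fps_comp f (row_mx A b) - fps_comp f (row_mx A b') =
            (b 0 0 - b' 0 0) * h.
Proof.
move=> A0 b0 b'0.
pose z : 'rV[fps K (n + 1 + 1)]_n := lsubmx (lsubmx fps_vars).
pose w : 'rV[fps K (n + 1 + 1)]_1 := rsubmx (lsubmx fps_vars).
pose t : 'rV[fps K (n + 1 + 1)]_1 := rsubmx fps_vars.
have v0 := @formal_map_vars K (n + 1 + 1).
have l0 := formal_map_lsubmx v0.
have z0 : formal_map z by apply: formal_map_lsubmx.
have w0 : formal_map w by apply: formal_map_rsubmx.
have t0 : formal_map t by apply: formal_map_rsubmx.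
have addF s (F G : 'rV[fps K s]_1) : formal_map F -> formal_map G -> formal_map (F + G).
  by move=> F0 G0 i; rewrite mxE fpsDE F0 G0 addr0.
have map_addF s s' (F G : 'rV[fps K s]_1) (g : 'rV[fps K s']_s) :
    formal_map g -> map_comp (F + G) g = map_comp F g + map_comp G g.
  by move=> g0; apply/rowP => i; rewrite !mxE fps_compD.
pose u := fps_comp f (row_mx z (w + t)) - fps_comp f (row_mx z w).
have zwt : formal_map (row_mx z (w + t)) by apply: formal_map_row_mx => //; apply: addF.
have zw : formal_map (row_mx z w) by apply: formal_map_row_mx.
have [h uE] : exists h, u = fps_last K (n + 1) * h.
  have s0 : formal_map (row_mx (@fps_vars K (n + 1)) (0 : 'rV_1)).
    by apply: formal_map_row_mx; [apply: formal_map_vars | apply: formal_map0].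
  apply: fps_divides_last; rewrite /u fps_compB !fps_compA // !map_comp_row_mx.
  rewrite map_addF // (map_rvars_comp (@formal_map_vars K _) (@formal_map0 K _ _)).
  by rewrite addr0 subrr.
pose s := row_mx (row_mx A b') (b - b').
have Ab0 : formal_map (row_mx A b') by apply: formal_map_row_mx.
have bb0 : formal_map (b - b').
  by move=> i; rewrite !mxE fpsBE b0 b'0 subrr.
have s0 : formal_map s by apply: formal_map_row_mx.
have zs : map_comp z s = A.
  by rewrite /z map_comp_lsubmx map_lvars_comp // row_mxKl.
have ws : map_comp w s = b'.
  by rewrite /w map_comp_rsubmx map_lvars_comp // row_mxKr.
have ts : map_comp t s = b - b' by rewrite /t map_rvars_comp.
exists (fps_comp h s).
have := congr1 (fun X => fps_comp X s) uE.
rewrite /u /= fps_compB !fps_compA // !map_comp_row_mx map_addF // zs ws ts subrKC.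
move=> ->; rewrite fps_compM // fps_comp_var // row_mxEr !mxE.
by [].
Qed.

End Difference.

(** * Maximal minors of Jacobians and generic rank *)

Section Rank.
Variable K : comNzRingType.

Lemma fps_comp_det n p q (A : 'M[fps K n]_q) (g : 'rV[fps K p]_n) :
  formal_map g -> fps_comp (\det A) g = \det (map_mx (fun f => fps_comp f g) A).
Proof.
move=> g0; rewrite fps_comp_sum //; apply: eq_bigr => s _.
rewrite fps_compM // fps_compX // fps_compN // fps_comp1 // fps_comp_prod //.
by congr (_ * _); apply: eq_bigr => i _; rewrite mxE.
Qed.

(** A form of the Cauchy-Binet formula: each row of the product is a combination of rows of [B], and
    the determinant is multilinear in rows. The sum runs over all selections [g]; a repeated row
    contributes 0. *)
Lemma det_mulmx_rowsub (R : comNzRingType) n q (A : 'M[R]_(n, q)) (B : 'M[R]_(q, n)) :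
  \det (A *m B) =
  \sum_(g : {ffun 'I_n -> 'I_q}) (\prod_i A i (g i)) * \det (rowsub g B).
Proof.
transitivity (\sum_(s : 'S_n) \sum_(g : {ffun 'I_n -> 'I_q})
    (-1) ^+ s * \prod_i (A i (g i) * B (g i) (s i))).
  apply: eq_bigr => s _; rewrite -mulr_sumr; congr (_ * _).
  by rewrite -(bigA_distr_bigA (fun i j => A i j * B j (s i))); apply: eq_bigr => i _; rewrite mxE.
rewrite exchange_big; apply: eq_bigr => g _; rewrite mulr_sumr.
apply: eq_bigr => s _; rewrite big_split /= mulrCA; congr (_ * (_ * _)).
by apply: eq_bigr => i _; rewrite !mxE.
Qed.

(* Every maximal minor is a combination of compositions of maximal minors with *)
(* [G], times [\det (jacobian G)], which vanishes at 0: the order of the       *)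
(* minors can be raised indefinitely.                                          *)
Lemma minors_eq0 n q (W : 'rV[fps K n]_q) (G : 'rV[fps K n]_n) (A : 'M[K]_q) :
  formal_map G -> W = map_comp W G *m map_mx (fps_const n) A ->
  \det (jacobian0 G) = 0 ->
  forall a : 'I_n -> 'I_q, \det (rowsub a (jacobian W)) = 0.
Proof.
move=> G0 WE dG a; pose J := jacobian W.
pose B : 'M[fps K n]_q := map_mx (fps_const n) A^T.
have JE : J = B *m map_mx (fun f => fps_comp f G) J *m jacobian G.
  rewrite -mulmxA -jacobian_comp //; apply/matrixP => i j.
  rewrite {1}/J {1}WE !mxE (continuous_additive_sum _ _ _ (continuous_additive_deriv K j)).
  apply: eq_bigr => k _; rewrite fps_derivM !mxE fps_deriv_const mulr0 addr0.
  by rewrite mulrC.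
have dG1 : ordge 1 (\det (jacobian G)).
  by apply/ordge1P; rewrite -dG; apply: (esym (det_map_mx (@fps_eval0 K n) _)).
suff all_d d : forall b : 'I_n -> 'I_q, ordge d (\det (rowsub b J)).
  by apply: ordge_eq => d; rewrite subr0; apply: all_d.
elim: d => [|d IH] b; first exact: ordge_0.
have -> : rowsub b J =
    rowsub b B *m map_mx (fun f => fps_comp f G) J *m jacobian G.
  by rewrite {1}JE !mul_rowsub_mx.
rewrite det_mulmx -addn1; apply: ordgeM => //.
rewrite det_mulmx_rowsub; apply: ordge_sum => g _; apply: ordgeMr.
by rewrite -map_mxsub -fps_comp_det //; apply: ordge_comp; apply: IH.
Qed.

Lemma generic_rank_minor n q (W : 'rV[fps K n]_q) : generic_rank W = n ->
  exists a : 'I_n -> 'I_q, \det (rowsub a (jacobian W)) != 0.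
Proof.
move=> rW.
suff : nonzero_minor (jacobian W) n.
  case/existsP => a /existsP [b]; move=> d0; exists a.
  apply: contraNneq d0 => d0.
  (* Selecting columns is a multiplication on the right, so a nonzero minor forces the minor with
     the same rows and all columns in order to be nonzero. *)
  have -> : mxsub a b (jacobian W) = rowsub a (jacobian W) *m colsub b 1%:M.
    apply/matrixP => i j; rewrite !mxE (bigD1 (b j)) //= !mxE eqxx mulr1.
    by rewrite big1 ?addr0 // => k kb; rewrite !mxE (negPf kb) mulr0.
  by rewrite det_mulmx d0 mul0r.
(* The empty minor equals 1, so the maximum defining the generic rank ranges over a nonempty set and
   is attained. *)
have nm0 : nonzero_minor (jacobian W) 0.
  apply/existsP; exists (ffun0 (card_ord 0)).
  by apply/existsP; exists (ffun0 (card_ord 0)); rewrite det_mx00 oner_neq0.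
have := eq_bigmax_cond (fun r : 'I_n.+1 => val r) (A := [pred r : 'I_n.+1 | nonzero_minor (jacobian W) r]).
case=> [|r rin rmax]; first by apply/card_gt0P; exists ord0.
have rn : val r = n by rewrite -[RHS]rW -rmax.
by move: rin; rewrite inE /= rn.
Qed.

End Rank.

Lemma map_comp_at0 (K : comNzRingType) n p q (F : 'rV[fps K n]_q) :
  formal_map F -> map_comp F (0 : 'rV[fps K p]_n) = 0.
Proof.
move=> F0; apply/rowP => i; rewrite !mxE; apply: fpsP => m.
rewrite fps_compE big1 ?fps0E // => k _; rewrite mpow0r.
by case: eqP => [->|_]; rewrite (F0, fps0E) (mul0r, mulr0).
Qed.

Ltac formal := repeat first
  [ assumption | apply: formal_map_vars | apply: formal_map0
  | apply: formal_map_row_mx | apply: formal_map_lsubmx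
  | apply: formal_map_rsubmx | apply: map_comp_formal ].

(** * Conjugation of coefficients *)

Section Conjugation.
Variable C : numClosedFieldType.

Fact fps_conj_is_zmod n : zmod_morphism (@fps_conj C n).
Proof. by move=> f g; apply: fpsP => m; rewrite /= rmorphB. Qed.

Fact fps_conj_is_monoid n : monoid_morphism (@fps_conj C n).
Proof.
split=> [|f g]; apply: fpsP => m.
  by rewrite /=; case: eqP => _; rewrite (rmorph1, rmorph0).
by rewrite /= rmorph_sum; apply: eq_bigr => k _; rewrite rmorphM.
Qed.

HB.instance Definition _ n := GRing.isZmodMorphism.Build (fps C n) (fps C n)
  (@fps_conj C n) (@fps_conj_is_zmod n).
HB.instance Definition _ n := GRing.isMonoidMorphism.Build (fps C n) (fps C n)
  (@fps_conj C n) (@fps_conj_is_monoid n).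

Lemma fps_conjK n : involutive (@fps_conj C n).
Proof. by move=> f; apply: fpsP => m; rewrite /= conjCK. Qed.

Lemma map_conjK n q : involutive (@map_conj C n q).
Proof. by move=> F; apply/matrixP => i j; rewrite !mxE fps_conjK. Qed.

Lemma fps_conj_comp n p (f : fps C n) (g : 'rV[fps C p]_n) :
  fps_conj (fps_comp f g) = fps_comp (fps_conj f) (map_conj g).
Proof.
have mE k : fps_conj (mpow g k) = mpow (map_conj g) k.
  by rewrite /mpow rmorph_prod; apply: eq_bigr => i _; rewrite rmorphXn mxE.
apply: fpsP => m; rewrite fps_compE [LHS]/= rmorph_sum.
by apply: eq_bigr => k _; rewrite rmorphM -mE.
Qed.

Lemma map_conj_comp n p q (F : 'rV[fps C n]_q) (g : 'rV[fps C p]_n) :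
  map_conj (map_comp F g) = map_comp (map_conj F) (map_conj g).
Proof. by apply/matrixP => i j; rewrite !mxE fps_conj_comp. Qed.

Lemma map_conj_row_mx n p q (A : 'rV[fps C n]_p) (B : 'rV[fps C n]_q) :
  map_conj (row_mx A B) = row_mx (map_conj A) (map_conj B).
Proof. exact: map_row_mx. Qed.

Lemma map_conj_lsubmx n p q (A : 'rV[fps C n]_(p + q)) :
  map_conj (lsubmx A) = lsubmx (map_conj A).
Proof. by rewrite /map_conj map_lsubmx. Qed.

Lemma map_conj_rsubmx n p q (A : 'rV[fps C n]_(p + q)) :
  map_conj (rsubmx A) = rsubmx (map_conj A).
Proof. by rewrite /map_conj map_rsubmx. Qed.

Lemma map_conj0 n q : map_conj (0 : 'rV[fps C n]_q) = 0.
Proof. by apply/matrixP => i j; rewrite !mxE raddf0. Qed.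

Lemma fps_conj_var n (i : 'I_n) : fps_conj (fps_var C i) = fps_var C i.
Proof. by apply: fpsP => m /=; case: eqP => _; rewrite (rmorph1, rmorph0). Qed.

Lemma map_conj_vars n : map_conj (@fps_vars C n) = fps_vars.
Proof. by apply/matrixP => i j; rewrite !mxE fps_conj_var. Qed.

Lemma map_conj_formal n q (F : 'rV[fps C n]_q) : formal_map F -> formal_map (map_conj F).
Proof. by move=> F0 i; rewrite mxE /= F0 rmorph0. Qed.

Lemma jacobian0_conj n q (F : 'rV[fps C n]_q) :
  jacobian0 (map_conj F) = map_mx Num.conj (jacobian0 F).
Proof. by apply/matrixP => i j; rewrite [RHS]mxE !jacobian0E mxE. Qed.

End Conjugation.

(** * Substitution into series in the variables [(z, chi, tau)] *)

Section Evaluation.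
Variables (C : numClosedFieldType) (n : nat).
Implicit Types Q : fps C (n + n + 1).

Lemma evalQ_comp Q p q (z chi : 'rV[fps C p]_n) tau (g : 'rV[fps C q]_p) :
  formal_map z -> formal_map chi -> formal_map tau -> formal_map g ->
  fps_comp (evalQ Q z chi tau) g =
  evalQ Q (map_comp z g) (map_comp chi g) (map_comp tau g).
Proof.
move=> z0 c0 t0 g0; rewrite /evalQ fps_compA ?map_comp_row_mx //; formal.
Qed.

Lemma qz_comp p (z chi : 'rV[fps C p]_n) (tau : 'rV[fps C p]_1) :
  formal_map z -> formal_map chi -> formal_map tau ->
  map_comp (@qz C n) (row_mx (row_mx z chi) tau) = z.
Proof.
move=> z0 c0 t0; rewrite /qz map_comp_lsubmx map_lvars_comp ?row_mxKl //; formal.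
Qed.

Lemma qchi_comp p (z chi : 'rV[fps C p]_n) (tau : 'rV[fps C p]_1) :
  formal_map z -> formal_map chi -> formal_map tau ->
  map_comp (@qchi C n) (row_mx (row_mx z chi) tau) = chi.
Proof.
move=> z0 c0 t0; rewrite /qchi map_comp_rsubmx map_lvars_comp ?row_mxKr //; formal.
Qed.

Lemma qtau_comp p (z chi : 'rV[fps C p]_n) (tau : 'rV[fps C p]_1) :
  formal_map z -> formal_map chi -> formal_map tau ->
  map_comp (@qtau C n) (row_mx (row_mx z chi) tau) = tau.
Proof. by move=> z0 c0 t0; rewrite /qtau map_rvars_comp //; formal. Qed.

Lemma qz_formal : formal_map (@qz C n). Proof. by rewrite /qz; formal. Qed.
Lemma qchi_formal : formal_map (@qchi C n). Proof. by rewrite /qchi; formal. Qed.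
Lemma qtau_formal : formal_map (@qtau C n). Proof. by rewrite /qtau; formal. Qed.

End Evaluation.

(** * The invariance equation of a self-map in normal coordinates *)

Section InvariantMap.
Variables (C : numClosedFieldType) (n m : nat) (Q Qt : fps C (n + n + 1)).
Variables (F : 'rV[fps C (n + 1)]_n) (G : 'rV[fps C (n + 1)]_1).

(** [Q] as a one-component map: replacing [w] by [Qs] restricts a series in [(z, w)] to the
    hypersurface, parametrized by [(z, chi, tau)]. *)
Let Qs : 'rV[fps C (n + n + 1)]_1 := const_mx Q.
Let Fb := map_conj F.
Let Gb := map_conj G.
Let z := lvars C n 1.
Let w := rvars C n 1.
Let T := fps_last C (n + n).
Let W := fps_last C n.

Hypothesis m_gt0 : (0 < m)%N.
Hypothesis QE : Q = qtau C n 0 0 + qtau C n 0 0 ^+ m * Qt.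
Hypothesis Qt_chi0 : evalQ Qt (qz C n) 0 (qtau C n) = 0.
Hypothesis F0 : formal_map F.
Hypothesis G0 : formal_map G.
(* The defining equation of the hypersurface at the image of (z, Q, chi, tau). *)
Hypothesis invariant : fps_comp (G 0 0) (row_mx (qz C n) Qs) =
  evalQ Q (map_comp F (row_mx (qz C n) Qs))
    (map_comp Fb (row_mx (qchi C n) (qtau C n)))
    (map_comp Gb (row_mx (qchi C n) (qtau C n))).

Let Fb0 : formal_map Fb. Proof. exact: map_conj_formal. Qed.
Let Gb0 : formal_map Gb. Proof. exact: map_conj_formal. Qed.
Let z0 : formal_map z. Proof. exact: lvars_formal. Qed.
Let w0 : formal_map w. Proof. exact: rvars_formal. Qed.
Let qz0 := @qz_formal C n.
Let qchi0 := @qchi_formal C n.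
Let qtau0 := @qtau_formal C n.

Let qtauE : qtau C n 0 0 = T. Proof. by rewrite /qtau !mxE. Qed.
Let wE : w 0 0 = W. Proof. by rewrite /w /rvars !mxE. Qed.

Let Qs0 : formal_map Qs.
Proof.
move=> i; rewrite mxE QE fpsDE qtau0 add0r.
by rewrite -[m]prednK // exprS -mulrA fpsME0 qtau0 mul0r.
Qed.

Lemma evalQt_chi0 p (a : 'rV[fps C p]_n) c : formal_map a -> formal_map c ->
  evalQ Qt a 0 c = 0.
Proof.
move=> a0 c0; have := congr1 (fun X => fps_comp X (row_mx (row_mx a 0) c)) Qt_chi0.
rewrite /= evalQ_comp; try by formal.
by rewrite qz_comp ?map_comp0 ?qtau_comp ?fps_comp0 //; formal.
Qed.

Lemma evalQ_expand p (a b : 'rV[fps C p]_n) c :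
  formal_map a -> formal_map b -> formal_map c ->
  evalQ Q a b c = c 0 0 + c 0 0 ^+ m * evalQ Qt a b c.
Proof.
move=> a0 b0 c0; have g0 : formal_map (row_mx (row_mx a b) c) by formal.
have tE : fps_comp (qtau C n 0 0) (row_mx (row_mx a b) c) = c 0 0.
  by rewrite -[c in RHS](qtau_comp a0 b0 c0) [RHS]mxE.
by rewrite /evalQ {1}QE (fps_comp_add_expM g0) tE.
Qed.

Lemma map_divides_last p (A : 'rV[fps C (p + 1)]_1) :
  map_comp A (row_mx fps_vars 0) = 0 -> exists g, A 0 0 = fps_last C p * g.
Proof.
move=> A0; apply: fps_divides_last.
by have := congr1 (fun X : 'rV_1 => X 0 0) A0; rewrite !mxE.
Qed.

Let s0 p : formal_map (row_mx (@fps_vars C p) (0 : 'rV_1)).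
Proof. by formal. Qed.

(** The series [conj(G)(0, w)], which depends on [w] alone but is regarded as a series in
    [(z, w)]. *)
Let gamma := map_comp Gb (row_mx 0 w).

Let gamma0 : formal_map gamma.
Proof. by rewrite /gamma; formal. Qed.

Let gamma_w0 : map_comp gamma (row_mx fps_vars 0) = 0.
Proof.
rewrite map_compA; try by formal.
rewrite map_comp_row_mx map_comp0 (map_rvars_comp (@formal_map_vars C n) (@formal_map0 C _ _)).
by rewrite row_mx0 map_comp_at0.
Qed.

(** At [chi = 0], [tau = w] one has [Q = w], and the invariance equation reads [G = gamma + gamma^m
    Qt(F, conj(F)(0, w), gamma)]. Here [gamma] is divisible by [w], and so is the [Qt] factor,
    because [conj(F)(0, 0) = 0] and [Qt] vanishes at [chi = 0]; together they give [w^(m+1)]. *)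
Lemma transversal_expansion : exists R, G 0 0 = gamma 0 0 + W ^+ m.+1 * R.
Proof.
pose g : 'rV[fps C (n + 1)]_(n + n + 1) := row_mx (row_mx z 0) w.
have g0 : formal_map g by rewrite /g; formal.
have Qsg : map_comp Qs g = w.
  apply/rowP => i; rewrite !mxE [LHS](evalQ_expand z0 (@formal_map0 C _ _) w0).
  by rewrite evalQt_chi0 // mulr0 addr0 ord1.
have zw : row_mx z w = fps_vars by apply: hsubmxK.
have e := congr1 (fun X => fps_comp X g) invariant; move: e => /=.
rewrite fps_compA; try by formal.
rewrite map_comp_row_mx [map_comp (qz C n) g]qz_comp //; last exact: formal_map0.
rewrite Qsg zw fps_comp_vars => ->.
rewrite evalQ_comp; try by formal.
rewrite !map_compA; try by formal.
rewrite !map_comp_row_mx /g qz_comp // ?qchi_comp ?qtau_comp //; try by formal.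
rewrite -/g Qsg zw map_comp_vars -/gamma.
have zw0 : formal_map (row_mx 0 w : 'rV[fps C (n+1)]_(n+1)) by formal.
rewrite evalQ_expand //; try by formal.
have [gamma1 gammaE] := map_divides_last gamma_w0.
have [X XE] : exists X, evalQ Qt F (map_comp Fb (row_mx 0 w)) gamma = W * X.
  apply: fps_divides_last; rewrite evalQ_comp; try by formal.
  rewrite gamma_w0 (map_compA _ zw0 (s0 (p := n))) map_comp_row_mx map_comp0.
  rewrite (map_rvars_comp (@formal_map_vars C n) (@formal_map0 C _ _)).
  by rewrite row_mx0 map_comp_at0 // evalQt_chi0 //; formal.
exists (gamma1 ^+ m * X); congr (_ + _).
by rewrite XE gammaE exprMn exprS; ring.
Qed.

(** Since [gamma] is a series in [w] alone without constant term, it is [c w + O(w^2)] with a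
    constant [c], and the correction [W ^+ m.+1 * R] is [O(w^2)] because [m] is positive. *)
Lemma linear_expansion : exists c E, G 0 0 = fps_const _ c * W + W ^+ 2 * E.
Proof.
have [R ->] := transversal_expansion; have [g1 gammaE] := map_divides_last gamma_w0.
pose i0 : 'rV[fps C (n + 1)]_(n + 1) := row_mx 0 w.
have i00 : formal_map i0 by rewrite /i0; formal.
(* Independence of [gamma] from [z]; it allows the quotient [g1] to be replaced by [g1(0, w)], whose
   value at [w = 0] is a constant. *)
have gamma_i0 : map_comp gamma i0 = gamma.
  rewrite map_compA //; congr map_comp.
  by rewrite {1}/i0 map_comp_row_mx map_comp0 map_rvars_comp //; formal.
have gammaE' : gamma 0 0 = W * fps_comp g1 i0.
  rewrite -[in LHS]gamma_i0 mxE gammaE fps_compM // fps_comp_var //.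
  by rewrite row_mxEr wE.
pose c := g1 0%MM; pose D : 'rV[fps C (n + 1)]_1 := const_mx (g1 - fps_const _ c).
have D0 : formal_map D by move=> i; rewrite mxE fpsBE /= eqxx subrr.
have [g2 g2E] : exists g2, map_comp D i0 0 0 = W * g2.
  apply: map_divides_last; rewrite map_compA //.
  rewrite map_comp_row_mx map_comp0 (map_rvars_comp (@formal_map_vars C n) (@formal_map0 C _ _)).
  by rewrite row_mx0 map_comp_at0.
exists c, (g2 + W ^+ m.-1 * R).
have -> : W ^+ m.+1 = W ^+ 2 * W ^+ m.-1 by rewrite -exprD add2n prednK.
have g1E : fps_comp g1 i0 = fps_const _ c + W * g2.
  by move: g2E; rewrite !mxE fps_compB fps_comp_const // => <-; ring.
by rewrite gammaE' g1E; ring.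
Qed.

Lemma W_comp p (a : 'rV[fps C p]_n) (b : 'rV[fps C p]_1) :
  formal_map a -> formal_map b -> fps_comp W (row_mx a b) = b 0 0.
Proof.
by move=> a0 b0; rewrite fps_comp_var ?row_mxEr //; formal.
Qed.

(** By [transversal_expansion] and its conjugate, each of [G] and [conj(G)] agrees modulo
    [tau^(m+1)] with the restriction of the other to the axis where the first variables vanish. *)
Lemma conj_difference : exists Y,
  fps_comp (Gb 0 0) (row_mx (qchi C n) (qtau C n)) =
  fps_comp (G 0 0) (row_mx (qz C n) (qtau C n)) + T ^+ m.+1 * Y.
Proof.
have [R GE] := transversal_expansion.
pose i1 : 'rV[fps C (n + n + 1)]_(n + 1) := row_mx 0 (qtau C n).
have GbE : Gb 0 0 = map_comp G (row_mx 0 w) 0 0 + W ^+ m.+1 * fps_conj R.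
  rewrite [LHS]mxE GE rmorphD rmorphM rmorphXn /= fps_conj_var; congr (_ + _).
  have -> : map_comp G (row_mx 0 w) = map_conj gamma; last by rewrite [RHS]mxE.
  rewrite map_conj_comp map_conjK map_conj_row_mx map_conj0.
  by rewrite /w /rvars map_conj_rsubmx map_conj_vars.
have red (D E : 'rV[fps C (n + 1)]_1) S (a : 'rV[fps C (n + n + 1)]_n) :
    formal_map E -> formal_map a ->
    D 0 0 = map_comp E (row_mx 0 w) 0 0 + W ^+ m.+1 * S ->
    exists S', fps_comp (D 0 0) (row_mx a (qtau C n)) =
               fps_comp (E 0 0) i1 + T ^+ m.+1 * S'.
  move=> E0 a0 ->; have at0 : formal_map (row_mx a (qtau C n)) by formal.
  exists (fps_comp S (row_mx a (qtau C n))).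
  rewrite (fps_comp_add_expM at0) (W_comp a0 qtau0) qtauE; congr (_ + _).
  rewrite mxE fps_compA //; last by formal.
  by rewrite map_comp_row_mx map_comp0 map_rvars_comp.
(* The chain of congruences is [conj(G)(chi, tau)] to [G(0, tau)], then to [conj(G)(0, tau)], then
   back to [G(z, tau)]. *)
have [S1 S1E] := red _ _ _ _ G0 qchi0 GbE.
have [S2 S2E] := red _ _ _ _ Gb0 (@formal_map0 C _ _) GE.
have [S3 S3E] := red _ _ _ _ Gb0 qz0 GE.
by exists (S1 + S2 - S3); rewrite S1E S2E S3E; ring.
Qed.

Let f := map_comp F (row_mx fps_vars 0).
Let fb := map_conj f.

(** In [G(z, Q) - conj(G)(chi, tau)] the terms of order below [m] in [tau] cancel: by
    [conj_difference] it equals [G(z, Q) - G(z, tau)] modulo [tau^(m+1)], and [Q - tau = tau^m Qt].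
    The other side of the equation is [conj(G)^m] times a value of [Qt], also divisible by
    [tau^m]. *)
Lemma reduced_identity c E : G 0 0 = fps_const _ c * W + W ^+ 2 * E ->
  fps_const _ c * at_tau0 Qt = fps_const _ (c ^+ m) *
    fps_comp (at_tau0 Qt) (row_mx (map_comp f (lvars C n n)) (map_comp fb (rvars C n n))).
Proof.
move=> GE; have [Y BE] := conj_difference.
have qzQ : formal_map (row_mx (qz C n) Qs) by formal.
have qzt : formal_map (row_mx (qz C n) (qtau C n)) by formal.
have qct : formal_map (row_mx (qchi C n) (qtau C n)) by formal.
have [u BT] : exists u, map_comp Gb (row_mx (qchi C n) (qtau C n)) 0 0 = T * u.
  exists (fps_const _ c + T * fps_comp E (row_mx (qz C n) (qtau C n)) + T ^+ m * Y).
  rewrite mxE BE GE (fps_comp_linear_expansion qzt) (W_comp qz0 qtau0) qtauE (exprS T m).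
  by ring.
move: invariant; rewrite evalQ_expand; try by formal.
set X := evalQ Qt _ _ _; rewrite [map_comp Gb _ 0 0]mxE BE GE.
rewrite (fps_comp_linear_expansion qzt) (fps_comp_linear_expansion qzQ).
rewrite (W_comp qz0 qtau0) (W_comp qz0 Qs0) qtauE.
rewrite [Qs 0 0]mxE.
set E1 := fps_comp E _; set E2 := fps_comp E _; set k := fps_const _ c.
(* The remainder [E] is evaluated at [(z, Q)] in [E1] and at [(z, tau)] in [E2]; the difference
   again carries the factor [Q - T = T^m Qt]. *)
have [h hE] : exists h, E1 - E2 = (Q - T) * h.
  have := fps_comp_sub_divides E qz0 Qs0 qtau0.
  by rewrite qtauE [Qs 0 0]mxE.
pose q := 1 + T ^+ m.-1 * Qt.
have TmE : T ^+ m = T * T ^+ m.-1 by rewrite -exprS prednK.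
have QT : Q = T + T ^+ m * Qt by move: QE; rewrite qtauE.
have Qq : Q = T * q by rewrite QT TmE /q; ring.
(* With [Q = T q], these are the error terms: [G(z, Q) - conj(G)(chi, tau)] is [T^m (k Qt + T Z)]
   and [conj(G)(chi, tau)] is [T (k + T Z')]. Both disappear at [T = 0]. *)
pose Z := Qt * (q + 1) * E2 + T * q ^+ 2 * Qt * h - Y.
pose Z' := E2 + T ^+ m.-1 * Y.
have -> : k * T + T ^+ 2 * E2 + T ^+ m.+1 * Y = T * (k + T * Z').
  by rewrite /Z' (exprS T m) TmE; ring.
have -> : E1 = E2 + (Q - T) * h by rewrite -hE; ring.
have TZ : T * Z = Qt * (Q + T) * E2 + Q ^+ 2 * Qt * h - T * Y.
  by rewrite Qq /Z; ring.
move=> main.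
have {}main : T ^+ m * (k * Qt + T * Z) = T ^+ m * ((k + T * Z') ^+ m * X).
  have -> : T ^+ m * ((k + T * Z') ^+ m * X) =
      k * Q + Q ^+ 2 * (E2 + (Q - T) * h) - T * (k + T * Z').
    by rewrite main exprMn; ring.
  rewrite TZ /Z'.
  have -> : T * (k + T * (E2 + T ^+ m.-1 * Y)) = k * T + T ^+ 2 * E2 + T ^+ m * T * Y.
    by rewrite TmE; ring.
  by rewrite QT; ring.
move/fps_var_exp_lreg: main => main.
have := congr1 (fun u => fps_comp u (row_mx fps_vars 0)) main.
have s0' := @s0 (n + n).
have Ts : fps_comp T (row_mx fps_vars 0) = 0.
  by rewrite (fps_comp_var s0') row_mxEr mxE.
have varsE : @fps_vars C (n + n) = row_mx (lvars C n n) (rvars C n n).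
  by rewrite hsubmxK.
have l0 := @lvars_formal C n n; have r0 := @rvars_formal C n n.
have zero0 p r := @formal_map0 C p r.
have Qss : map_comp Qs (row_mx fps_vars 0) = 0.
  by apply/rowP => i; rewrite [LHS]mxE [RHS]mxE [Qs 0 i]mxE Qq (fps_compM s0') Ts mul0r.
rewrite /= (fps_comp_const_addM s0' _ _ _ Ts) (fps_comp_exp_constM s0' _ _ _ _ Ts).
move=> {}main.
have QtE : fps_comp Qt (row_mx fps_vars 0) = at_tau0 Qt.
  by rewrite /at_tau0 /evalQ hsubmxK.
rewrite -QtE main rmorphXn; congr (_ * _).
have f0 : formal_map f by rewrite /f; formal.
have fb0 : formal_map fb by apply: map_conj_formal.
have fE : map_comp f (lvars C n n) = map_comp F (row_mx (lvars C n n) 0).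
  by rewrite map_compA // map_comp_row_mx map_vars_comp // map_comp0.
have fbE : map_comp fb (rvars C n n) = map_comp Fb (row_mx (rvars C n n) 0).
  rewrite /fb map_conj_comp map_conj_row_mx map_conj_vars map_conj0.
  by rewrite map_compA // map_comp_row_mx map_vars_comp // map_comp0.
rewrite evalQ_comp; try by formal.
have -> : map_comp (map_comp Gb (row_mx (qchi C n) (qtau C n))) (row_mx fps_vars 0) = 0.
  apply/rowP => i; rewrite [LHS]mxE ord1 BT (fps_compM s0') Ts mul0r.
  by rewrite mxE.
rewrite !map_compA // !map_comp_row_mx Qss varsE qz_comp // qchi_comp // qtau_comp //.
rewrite -fE -fbE /at_tau0 evalQ_comp; try by formal.
rewrite map_lvars_comp ?map_rvars_comp ?map_comp0 //; formal.
by rewrite map_vars_comp // -fE.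
Qed.

(** Taking the coefficient of [z^alpha] in [reduced_identity] yields the relation that [minors_eq0]
    requires; a vanishing Jacobian determinant would then annihilate the minor supplied by the
    generic rank. *)
Lemma det_jacobian_fb k c E : c != 0 -> G 0 0 = fps_const _ c * W + W ^+ 2 * E ->
  generic_rank (coef_z_map (at_tau0 Qt) k) = n -> \det (jacobian0 fb) != 0.
Proof.
move=> c0 GE /generic_rank_minor [a]; apply: contraNneq => dfb.
have f0 : formal_map f by rewrite /f; formal.
have fb0 : formal_map fb by apply: map_conj_formal.
pose I := 'X_{1..n < k.+1}.
(* The entry is the coefficient of [z^alpha] in [f^beta], with [beta] indexing rows and [alpha]
   columns, scaled by the factor left after division by [c]. *)
pose A : 'M[C]_#|{: I}| := \matrix_(j, i)
  (c^-1 * c ^+ m * mpow f (enum_val j : I) (enum_val i : I)).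
rewrite (minors_eq0 (A := A) fb0 _ dfb) //; apply/rowP => i.
rewrite [LHS]mxE; set alpha := (enum_val i : I).
rewrite [X in coef_z X _](_ : _ = fps_const _ (c^-1 * c ^+ m) * fps_comp (at_tau0 Qt)
    (row_mx (map_comp f (lvars C n n)) (map_comp fb (rvars C n n)))); last first.
  rewrite rmorphM -mulrA -(reduced_identity GE) mulrA -rmorphM mulVf //.
  by rewrite rmorph1 mul1r.
rewrite coef_zZ (coef_z_comp _ f0 fb0 (bmdeg alpha)).
rewrite (big_enum_val (A := {: I})) /= mulr_sumr [RHS]mxE.
apply: eq_bigr => j _; rewrite !mxE mulrCA; congr (_ * _).
by rewrite [in RHS]rmorphM.
Qed.

End InvariantMap.

(** * Linear parts at the origin *)

Section Gradient.
Variables (C : numClosedFieldType) (n : nat).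

Lemma jacobian0_const_mxM p (f g : fps C p) : f 0%MM = 0 ->
  jacobian0 (const_mx (g * f) : 'rV_1) = g 0%MM *: jacobian0 (const_mx f : 'rV_1).
Proof.
move=> f0; apply/matrixP => i j; rewrite !mxE fps_derivM fpsDE !fpsME0 f0 mulr0 add0r.
by [].
Qed.

Lemma jacobian0_row_mx p q s (A : 'rV[fps C s]_p) (B : 'rV[fps C s]_q) :
  jacobian0 (row_mx A B) = col_mx (jacobian0 A) (jacobian0 B).
Proof.
apply/matrixP => i j; rewrite [LHS]mxE.
by case: (split_ordP i) => k ->; rewrite (col_mxEu, col_mxEd) !mxE (unsplitK (inl k), unsplitK (inr k)).
Qed.

Lemma jacobian0_vars p : jacobian0 (@fps_vars C p) = 1%:M.
Proof.
apply/matrixP => i j; rewrite jacobian0E !mxE /= eq_mnm1 eq_sym.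
by case: eqP.
Qed.

Lemma jacobian0_0 p q : jacobian0 (0 : 'rV[fps C p]_q) = 0.
Proof. by apply/matrixP => i j; rewrite jacobian0E !mxE fps0E. Qed.

(** The gradient in [Z] at 0 sees only [r(Z, 0)]; as a Jacobian it becomes subject to the chain rule
    under changes of coordinates. *)
Lemma dZ0E p (r : fps C (p + p)) :
  dZ0 r = jacobian0 (const_mx (fps_comp r (row_mx fps_vars 0)) : 'rV_1).
Proof.
apply/rowP => i; rewrite jacobian0E !mxE fps_comp_right0 /= mnm0E add0m.
congr (r _); apply/mnmP => j; rewrite [RHS]mnmE mnm1E.
case: split_ordP => k ->; first by rewrite mnm1E eq_lshift.
by rewrite mnm0E eq_lrshift.
Qed.

End Gradient.

(** * Transport of the self-map to normal coordinates *)

Section Normalization.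
Variables (C : numClosedFieldType) (n : nat).
Variables (r : fps C ((n + 1) + (n + 1))) (phi : 'rV[fps C (n + 1)]_(n + 1)).
Variables (Q : fps C (n + n + 1)) (H H' : 'rV[fps C (n + 1)]_(n + 1)).
Hypothesis r_normal : normal_coordinates r phi Q.
Hypotheses (H0 : formal_map H) (H'0 : formal_map H').
Hypothesis H'E : map_comp phi H' = map_comp H phi.
Hypothesis r_H : maps_into_itself r H.

Let phi0 : formal_map phi. Proof. by case: r_normal => -[]. Qed.
Let varZ0 : formal_map (varZ C (n + 1)). Proof. by rewrite /varZ; formal. Qed.
Let varzeta0 : formal_map (varzeta C (n + 1)). Proof. by rewrite /varzeta; formal. Qed.
Let qz0 := @qz_formal C n.
Let qchi0 := @qchi_formal C n.
Let qtau0 := @qtau_formal C n.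
Let rho := nw C n 0 0 - evalQ Q (nz C n) (nchi C n) (ntau C n).

Lemma rho_evalQ p (Z zeta : 'rV[fps C p]_(n + 1)) : formal_map Z -> formal_map zeta ->
  fps_comp rho (row_mx Z zeta) =
  rsubmx Z 0 0 - evalQ Q (lsubmx Z) (lsubmx zeta) (rsubmx zeta).
Proof.
move=> Z0 zeta0; have g0 : formal_map (row_mx Z zeta) by formal.
have Zg : map_comp (varZ C (n + 1)) (row_mx Z zeta) = Z by apply: map_lvars_comp.
have zetag : map_comp (varzeta C (n + 1)) (row_mx Z zeta) = zeta by apply: map_rvars_comp.
rewrite /rho fps_compB; congr (_ - _).
  by rewrite -[in RHS]Zg -map_comp_rsubmx [RHS]mxE.
rewrite evalQ_comp; try by rewrite /nz /nchi /ntau; formal.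
by rewrite /nz /nchi /ntau (map_comp_lsubmx (varZ _ _)) (map_comp_lsubmx (varzeta _ _))
  (map_comp_rsubmx (varzeta _ _)) Zg zetag.
Qed.

(** With [Phi] the change of coordinates in [(Z, zeta)], one has [rho = v r(Phi)], [r(Phi) = u rho]
    and [r(H) = a r]. As [H'] is conjugate to [H] by [phi], [rho(H') = v(H') r(H(Phi)) = v(H')
    a(Phi) u rho]. *)
Lemma rho_invariant : in_ideal rho
  (fps_comp rho (row_mx (map_comp H' (varZ C _)) (map_comp (map_conj H') (varzeta C _)))).
Proof.
case: r_normal => _ _ _ ideal.
have [v rhoE] := (ideal rho).2 (ex_intro _ 1 (esym (mul1r rho))).
have [u rho0E] := (ideal _).1 (ex_intro _ 1 (esym (mul1r _))).
have [a aE] := r_H.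
have Hb0 := map_conj_formal H0; have Hb'0 := map_conj_formal H'0.
have phib0 := map_conj_formal phi0.
set S := row_mx _ _.
have S0 : formal_map S by rewrite /S; formal.
have H'bE : map_comp (map_conj phi) (map_conj H') = map_comp (map_conj H) (map_conj phi).
  by rewrite -!map_conj_comp H'E.
pose T := row_mx (map_comp phi (varZ C (n + 1))) (map_comp (map_conj phi) (varzeta C (n + 1))).
have T0 : formal_map T by rewrite /T; formal.
have ZS : map_comp (varZ C (n + 1)) S = map_comp H' (varZ C _).
  by apply: map_lvars_comp; formal.
have zetaS : map_comp (varzeta C (n + 1)) S = map_comp (map_conj H') (varzeta C _).
  by apply: map_rvars_comp; formal.
have ZT : map_comp (varZ C (n + 1)) T = map_comp phi (varZ C _).
  by apply: map_lvars_comp; formal.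
have zetaT : map_comp (varzeta C (n + 1)) T = map_comp (map_conj phi) (varzeta C _).
  by apply: map_rvars_comp; formal.
exists (fps_comp v S * (fps_comp a T * u)).
rewrite [in LHS]rhoE fps_compM // -!mulrA -rho0E; congr (_ * _).
transitivity (fps_comp (a * r) T); last by rewrite fps_compM.
(* The intertwining relation is applied twice, to the [Z] variables with [phi] and to the [zeta]
   variables with its conjugate. *)
have half (f h h' : 'rV[fps C (n + 1)]_(n + 1)) (x : 'rV_(n + 1)) :
    formal_map f -> formal_map h' -> formal_map x ->
    map_comp x S = map_comp h' x -> map_comp x T = map_comp f x ->
    map_comp f h' = map_comp h f ->
    map_comp (map_comp f x) S = map_comp (map_comp h x) T.
  move=> f0 h'0 x0 xS xT fh.
  rewrite (map_compA _ x0 S0) xS -(map_compA _ h'0 x0) fh.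
  by rewrite (map_compA _ f0 x0) -xT (map_compA _ x0 T0).
have HT0 : formal_map (row_mx (map_comp H (varZ C _)) (map_comp (map_conj H) (varzeta C _))).
  by formal.
rewrite -aE (fps_compA _ T0 S0) (fps_compA _ HT0 T0) /T !map_comp_row_mx -/T.
rewrite (half _ _ _ _ phi0 H'0 varZ0 ZS ZT H'E).
by rewrite (half _ _ _ _ phib0 Hb'0 varzeta0 zetaS zetaT H'bE).
Qed.

(** On the parametrization [(z, Q, chi, tau)] the generator [rho] vanishes, so membership in its
    ideal becomes an equation. *)
Lemma invariant_in_normal_coordinates :
  fps_comp (rsubmx H' 0 0) (row_mx (qz C n) (const_mx Q)) =
  evalQ Q (map_comp (lsubmx H') (row_mx (qz C n) (const_mx Q)))
    (map_comp (map_conj (lsubmx H')) (row_mx (qchi C n) (qtau C n)))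
    (map_comp (map_conj (rsubmx H')) (row_mx (qchi C n) (qtau C n))).
Proof.
have [b bE] := rho_invariant.
have Q00 : Q 0%MM = 0.
  case: r_normal => _ Q00 _ _.
  have -> : Q 0%MM = evalQ Q 0 (qchi C n) (qtau C n) 0%MM.
    by rewrite /evalQ fps_comp_at0 //; formal.
  by rewrite Q00 qtau0.
have Qs0 : formal_map (const_mx Q : 'rV_1) by move=> i; rewrite mxE.
pose g1 : 'rV[fps C (n + n + 1)]_(n + 1) := row_mx (qz C n) (const_mx Q).
pose g2 : 'rV[fps C (n + n + 1)]_(n + 1) := row_mx (qchi C n) (qtau C n).
have g10 : formal_map g1 by rewrite /g1; formal.
have g20 : formal_map g2 by rewrite /g2; formal.
have E0 : formal_map (row_mx g1 g2) by formal.
have Hb'0 := map_conj_formal H'0.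
have := congr1 (fun f => fps_comp f (row_mx g1 g2)) bE.
rewrite /= fps_compM // (rho_evalQ g10 g20) !row_mxKl !row_mxKr.
have -> : evalQ Q (qz C n) (qchi C n) (qtau C n) = Q.
  by rewrite /evalQ /qz /qchi /qtau !hsubmxK fps_comp_vars.
rewrite mxE subrr mulr0 fps_compA //; last by formal.
rewrite map_comp_row_mx !map_compA //.
have -> : map_comp (varZ C (n + 1)) (row_mx g1 g2) = g1 by apply: map_lvars_comp.
have -> : map_comp (varzeta C (n + 1)) (row_mx g1 g2) = g2 by apply: map_rvars_comp.
rewrite rho_evalQ; try by formal.
move/eqP; rewrite subr_eq0 => /eqP.
rewrite -!map_comp_lsubmx -!map_comp_rsubmx -map_conj_lsubmx -map_conj_rsubmx.
by rewrite [X in X = _ -> _]mxE.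
Qed.

End Normalization.

(** * CR transversality and the conclusion *)

Lemma rank1_transversal (K : fieldType) N (d : 'rV[K]_N) (J : 'M[K]_N) :
  d != 0 -> row_full (kermx d^T + J^T)%MS -> d *m J != 0.
Proof.
move=> d0 full; apply: contraNneq d0 => dJ.
(* If [d *m J = 0], the image of [J] lies in the hyperplane [ker d], so the sum is that hyperplane,
   a proper subspace. *)
have JK : (J^T <= kermx d^T)%MS.
  by apply/sub_kermxP; rewrite -trmx_mul dJ trmx0.
move: full; rewrite -sub1mx => /submx_trans full.
have : (1%:M <= kermx d^T)%MS by apply: full; rewrite addsmx_sub submx_refl.
move/sub_kermxP; rewrite mul1mx => /(congr1 trmx).
by rewrite trmxK trmx0 => ->; rewrite eqxx.
Qed.

Lemma transversal_class_C_invertible (C : numClosedFieldType) n m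
    (r : fps C ((n + 1) + (n + 1))) (H : 'rV[fps C (n + 1)]_(n + 1)) :
  dZ0 r != 0 -> (0 < m)%N -> class_C m r ->
  formal_map H -> CR_transversal r H -> maps_into_itself r H -> invertible_map H.
Proof.
move=> dr m0 [phi [Q [Qt [[normal [QE Qt_chi0 _ _]] [k0 /(_ _ (leqnn k0)) rank]]]]].
move=> H0 transv invar; split=> //.
have [[phi0 dphi] _ Qchi0 ideal] := normal.
have [H' H'0 H'E] := formal_solve phi0 dphi (map_comp_formal phi0 H0).
pose F := lsubmx H'; pose G := rsubmx H'.
have F0 : formal_map F by apply: formal_map_lsubmx.
have G0 : formal_map G by apply: formal_map_rsubmx.
have basic := invariant_in_normal_coordinates normal H0 H'0 H'E invar.
have [c [E GE]] := linear_expansion m0 QE Qt_chi0 F0 G0 basic.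
have jG : jacobian0 G = row_mx 0 c%:M.
  apply/matrixP => i j; rewrite jacobian0E (ord1 i) GE fpsDE.
  rewrite (_ : (fps_last C n ^+ 2 * E) _ = 0); last first.
    apply: (@ordgeMl _ _ 2); last by rewrite mdeg1.
    by apply/ordgeX/ordge1P; rewrite /= eq_sym mnm1_eq0.
  rewrite addr0 mulrC fps_mul_constr /= eq_mnm1 mxE.
  case: split_ordP => k ->; rewrite mxE ?eq_lrshift ?mul0r //.
  by rewrite !ord1 !eqxx mul1r.
have jH' : jacobian0 H' =
    block_mx (lsubmx (jacobian0 F)) (rsubmx (jacobian0 F)) 0 c%:M.
  by rewrite /block_mx -jG hsubmxK -jacobian0_row_mx hsubmxK.
have conjugate : jacobian0 phi *m jacobian0 H' = jacobian0 H *m jacobian0 phi.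
  by rewrite -!jacobian0_comp // H'E.
have c_neq0 : c != 0.
  have s0 : formal_map (row_mx (@fps_vars C (n + 1)) (0 : 'rV_(n + 1))) by formal.
  pose r1 := fps_comp r (row_mx (@fps_vars C (n + 1)) 0).
  have [u uE] := (ideal _).1 (ex_intro _ 1 (esym (mul1r _))).
  pose e := dZ0 r *m jacobian0 phi.
  (* At [chi = tau = 0] the series [Q] vanishes, so [r(phi(z, w), 0)] is a multiple of [w] and its
     gradient at 0 is proportional to [(0, 1)]. *)
  have eE : e = fps_comp u (row_mx fps_vars 0) 0%MM *: row_mx 0 1%:M.
    have r1phi : fps_comp r1 phi = fps_comp u (row_mx fps_vars 0) * fps_last C n.
      have phib0 := map_conj_formal phi0.
      have vZ0 : formal_map (varZ C (n + 1)) by rewrite /varZ; formal.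
      have vzeta0 : formal_map (varzeta C (n + 1)) by rewrite /varzeta; formal.
      have zero0 := @formal_map0 C (n + 1) (n + 1).
      have vars0 := @formal_map_vars C (n + 1).
      have := congr1 (fun f => fps_comp f (row_mx fps_vars 0)) uE.
      rewrite /= (fps_compM s0) (rho_evalQ Q vars0 zero0) fps_compA; try by formal.
      rewrite map_comp_row_mx !(map_compA _ _ s0) //.
      rewrite (map_lvars_comp vars0 zero0) (map_rvars_comp vars0 zero0).
      rewrite map_comp_vars map_comp_at0 //.
      rewrite (evalQ_expand QE); try by formal.
      have c00 : rsubmx (0 : 'rV[fps C (n + 1)]_(n + 1)) 0 0 = 0 by rewrite !mxE.
      rewrite c00 expr0n (gtn_eqF m0) mul0r addr0 subr0.
      rewrite /r1 (fps_compA _ s0 phi0) map_comp_row_mx map_vars_comp // map_comp0 => ->.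
      by congr (_ * _); rewrite !mxE.
    rewrite /e dZ0E -jacobian0_comp //.
    rewrite (_ : map_comp _ phi = const_mx (fps_comp r1 phi)); last exact: map_const_mx.
    rewrite r1phi jacobian0_const_mxM; last by rewrite /= eq_sym mnm1_eq0.
    congr (_ *: _); apply/matrixP => i j; rewrite jacobian0E !mxE /= eq_mnm1.
    by case: split_ordP => k ->; rewrite mxE ?eq_lrshift // !ord1 !eqxx.
  have := rank1_transversal dr transv; apply: contraNneq => c0.
  have uphi : jacobian0 phi \in unitmx by rewrite unitmxE unitfE.
  (* After multiplication by the invertible [dphi], the product [dZ0 r *m dH] becomes [e *m dH'], a
     multiple of the last row [(0, c)] of [dH']; it would be 0 if [c] were. *)
  apply/eqP/(can_inj (mulmxK uphi)); rewrite mul0mx -mulmxA -conjugate mulmxA -/e eE.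
  by rewrite -scalemxAl jH' mul_row_block !mul0mx !mul1mx !add0r c0 raddf0 row_mx0 scaler0.
have dfb := det_jacobian_fb m0 QE Qt_chi0 F0 G0 basic c_neq0 GE rank.
(* Hence [det dH = det dH'], which is [det df(0)] times [c] by block triangularity; [dfb] gives the
   nonvanishing of the conjugate of [det df(0)]. *)
have := congr1 determinant conjugate; rewrite !det_mulmx [RHS]mulrC.
move=> /(mulfI dphi) <-; rewrite jH' det_ublock det_scalar1 mulf_neq0 //.
move: dfb; rewrite jacobian0_conj det_map_mx fmorph_eq0 jacobian0_comp //; last by formal.
rewrite jacobian0_row_mx jacobian0_vars jacobian0_0.
by rewrite -{1}(hsubmxK (jacobian0 F)) mul_row_col mulmx1 mulmx0 addr0.
Qed.

Theorem theorem3p10 (R : realType) (n m : nat)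
    (r : fps R[i] ((n + 1) + (n + 1)))
    (hM : real_hypersurface r) (hm : (1 <= m)%N) (hC : class_C m r)
    (H : 'rV[fps R[i] (n + 1)]_(n + 1))
    (hH : formal_map H) (hT : CR_transversal r H) (hS : maps_into_itself r H) :
  invertible_map H.
Proof.
case: hM => _ _ dr.
exact: (transversal_class_C_invertible dr hm hC hH hT hS).
Qed.
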